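(* Let $k\geq 3$ be an odd integer and let $n,s$ be integers with $3\leq s\leq n-2$. Then $smp^{k}(A_{n,s})=s(n-s)$.
   Context: The arrangement graph $A_{n,s}$ ($n\geq 2$, $1\leq s\leq n-1$) has as vertices all sequences $[a_1,\dots,a_s]$ of $s$ distinct elements of $\{1,\dots,n\}$, two vertices being adjacent iff they differ in exactly one position; it is $s(n-s)$-regular. An integer $k$-matching of $G$ is a function $h:E(G)\to\{0,1,\dots,k\}$ with $\sum_{e\in\Gamma(v)}h(e)\leq k$ for all $v$ ($\Gamma(v)$ the edges incident with $v$); it is perfect if every vertex has sum $k$, and almost perfect if exactly one vertex has sum $k-1$ and all others have sum $k$. For $F\subseteq V(G)\cup E(G)$, $G-F$ is obtained by deleting the vertices of $F$ (with incident edges) and the edges of $F$. $smp^{k}(G)$ is the minimum size of $F\subseteq V(G)\cup E(G)$ such that $G-F$ has neither a perfect nor an almost perfect integer $k$-matching. *)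

(* Defs.v *)
From mathcomp Require Import all_boot.
Set Implicit Arguments. Unset Strict Implicit. Unset Printing Implicit Defensive.

(* A finite simple graph is given by a vertex set V : {set T} and an edge set
   Es : {set {set T}} whose elements are 2-element subsets of V. *)
Section GenericGraph.
Variable T : finType.

Definition del_vertices (V FV : {set T}) : {set T} := V :\: FV.
Definition del_edges (Es : {set {set T}}) (FV : {set T}) (FE : {set {set T}})
  : {set {set T}} := [set e in Es :\: FE | [disjoint e & FV]].

Definition hdeg (k : nat) (Es : {set {set T}}) (h : {ffun {set T} -> 'I_k.+1})
  (v : T) : nat := \sum_(e in Es | v \in e) (h e : nat).

(* h : E(G) -> {0,...,k} (values outside Es are irrelevant) is an integer
   k-matching *)
Definition int_kmatching k (V : {set T}) Es (h : {ffun {set T} -> 'I_k.+1}) :=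
  [forall v in V, hdeg Es h v <= k].

Definition perfect_int_kmatching k (V : {set T}) Es
  (h : {ffun {set T} -> 'I_k.+1}) :=
  [forall v in V, hdeg Es h v == k].

Definition almost_perfect_int_kmatching k (V : {set T}) Es
  (h : {ffun {set T} -> 'I_k.+1}) :=
  [&& int_kmatching V Es h,
      #|[set v in V | hdeg Es h v == k.-1]| == 1 &
      [forall v in V, (hdeg Es h v == k) || (hdeg Es h v == k.-1)]].

Definition has_perfect_or_almost_perfect k (V : {set T}) Es :=
  [exists h : {ffun {set T} -> 'I_k.+1},
     perfect_int_kmatching V Es h || almost_perfect_int_kmatching V Es h].

Definition smp_destroys k (V : {set T}) (Es : {set {set T}})
  (F : {set T} * {set {set T}}) :=
  [&& F.1 \subset V, F.2 \subset Es &
      ~~ has_perfect_or_almost_perfect k (del_vertices V F.1)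
                                         (del_edges Es F.1 F.2)].

(* smp^k(G) = min |F| over such F (|F| = |FV| + |FE|); the default value
   |V|+|E| is only used if no such F exists. *)
Definition smp k (V : {set T}) (Es : {set {set T}}) : nat :=
  \big[minn/(#|V| + #|Es|)]_(F : {set T} * {set {set T}} | smp_destroys k V Es F)
     (#|F.1| + #|F.2|).
End GenericGraph.

Definition arr_vertex (n s : nat) := {f : {ffun 'I_s -> 'I_n} | injectiveb f}.

Definition arr_adj (n s : nat) (u v : arr_vertex n s) : bool :=
  #|[set i : 'I_s | val u i != val v i]| == 1.

Definition arr_V (n s : nat) : {set arr_vertex n s} := setT.

Definition arr_E (n s : nat) : {set {set arr_vertex n s}} :=
  [set e : {set arr_vertex n s} |
     [exists u, exists v, (e == [set u; v]) && arr_adj u v]].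

(* Main.v *)
(* Replacing every vertex by k independent copies turns integer k-matchings into
   matchings, so Tutte's theorem yields: if G - F has neither a perfect nor an
   almost perfect integer k-matching, there is a vertex set S such that, among
   the components of G - F - S, i are isolated vertices and c are not, with
   k i + c > k |S| + 1.

   Put t = n - s and d = s t, and suppose that F has fewer than d elements.
   Slicing A_{n,s} by the value in one position and induction on the number of
   free positions show that separating nonempty vertex sets Z and B costs at
   least d deletions of vertices and edges, and at least
   d - 1 + min(|Z|, |B|, d - 1) when s >= 3.  If |S| <= d - 2, the second bound
   leaves one component that misses at most |S| vertices, so c + i <= |S| + 1
   and c > 0.  If |S| >= d - 1, count pairs (deleted vertex, adjacent
   component): every component needs d of them or of the faulty edges, while a
   vertex lies in s cliques, each meeting one component unless it contains
   faulty edges; this gives c + i <= |S|.  Both cases contradict the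
   inequality.  Conversely, deleting the d edges at one vertex isolates it. *)
Require Import Defs.
From mathcomp Require Import all_boot fingroup perm zify.
Set Implicit Arguments. Unset Strict Implicit. Unset Printing Implicit Defensive.

(** * Tutte's theorem *)

(** Components are replaced throughout by a labelling that is constant along the surviving edges;
    bounding the number of its values is all that is needed.

    The cost of separating Z from B has three sources, read off one position. A value taken by both
    sets gives a slice with one free position less, hence induction. A value taken only by Z against
    one taken only by B gives parallel edges between two slices, each of them blocked. If all values
    of B are also taken by Z, the edges from B towards the values that B avoids have to be blocked.
    The obstacle is a cell with two free positions and no common value in either: parallel edges
    then give only t instead of 2 t, and off-diagonal points of a grid are counted instead.

    The summand min(|Z|, |B|, d - 1) is what meets the barrier: with m = |S| there are at most m + d
    - 1 deletions, so for m <= d - 2 two separated sides cannot both exceed m vertices. The final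
    inequality is then violated with no room to spare: c + i <= m + 1 and c > 0 give k i + c <= k (m
    + 1) - (k - 1) c <= k m + 1. *)

Lemma set2_eq (T : finType) (a b c d : T) : a != b -> [set a; b] = [set c; d] ->
  (a = c /\ b = d) \/ (a = d /\ b = c).
Proof.
move=> ab E; have /set2P[ac|ad] : a \in [set c; d] by rewrite -E set21.
  have : b \in [set c; d] by rewrite -E set22.
  by case/set2P=> [bc|bd]; [rewrite ac bc eqxx in ab|left].
have : b \in [set c; d] by rewrite -E set22.
by case/set2P=> [bc|bd]; [right|rewrite ad bd eqxx in ab].
Qed.

Section Tutte.
Variable T : finType.
Implicit Types (e : rel T) (f : T -> T) (U W : {set T}) (l : T -> T).

(** [l] stands in for the components of the graph without [U]: when it is constant along the edges
    there, every odd class contains an odd component. [W] is the part still to be matched, so the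
    count can be followed through a greedy matching. *)
Definition odd_labels U l W : {set T} :=
  [set y | odd #|[set x in W :\: U | l x == y]|].

Lemma odd_labels_sub U l W : odd_labels U l W \subset l @: (W :\: U).
Proof.
apply/subsetP=> y; rewrite inE => Hodd.
have : 0 < #|[set x in W :\: U | l x == y]| by case: #|_| Hodd.
by case/card_gt0P=> x; rewrite inE => /andP[Hx /eqP<-]; apply: imset_f.
Qed.

Lemma odd_card_labels U l W : odd #|odd_labels U l W| = odd #|W :\: U|.
Proof.
have ->: #|W :\: U| = \sum_y #|[set x in W :\: U | l x == y]|.
  rewrite -sum1_card (partition_big l xpredT) //=.
  by apply: eq_bigr => y _; rewrite -sum1_card; apply: eq_bigl => x; rewrite inE.
rewrite -sum1_card big_mkcond /=.
rewrite !(big_morph odd oddD (erefl : odd 0 = false)).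
by apply: eq_bigr => y _; rewrite inE; case: (odd #|_|).
Qed.

Lemma extend_matching e W x y :
  symmetric e -> x != y -> x \in W -> y \in W -> e x y ->
  (exists f, forall z, z \in W :\: [set x; y] ->
     [/\ f z \in W :\: [set x; y], f (f z) = z & e z (f z)]) ->
  exists f, forall z, z \in W -> [/\ f z \in W, f (f z) = z & e z (f z)].
Proof.
move=> Hsym xy xW yW exy [f Hf].
exists (fun z => if z == x then y else if z == y then x else f z) => z zW.
case: (eqVneq z x) => [->|zx]; first by rewrite eq_sym (negPf xy) eqxx.
case: (eqVneq z y) => [->|zy]; first by rewrite eqxx Hsym.
have [|+ -> ez] := Hf z; first by rewrite !inE (negPf zx) (negPf zy).
by rewrite !inE negb_or => /andP[/andP[/negPf-> /negPf->] ->].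
Qed.

(** Greedy: pairing two vertices of one class changes no parity. Once each class has at most one
    vertex left, the hypothesis says that at most as many vertices remain outside [U] as inside, so
    each gets a partner in [U]; what is left of [U] is a clique of even size. *)
Lemma clique_matching e U l W :
  symmetric e -> (forall u x, u \in U -> x != u -> e u x) ->
  (forall x y, x \notin U -> y \notin U -> x != y -> l x = l y -> e x y) ->
  ~~ odd #|W| -> #|odd_labels U l W| <= #|W :&: U| ->
  exists f, forall x, x \in W -> [/\ f x \in W, f (f x) = x & e x (f x)].
Proof.
move=> Hsym HU Hl; have [m] := ubnP #|W|; elim: m W => // m IH W Hm evW HW.
have step x y : x != y -> x \in W -> y \in W -> e x y ->
    #|odd_labels U l (W :\: [set x; y])| <= #|(W :\: [set x; y]) :&: U| ->
    exists f, forall z, z \in W -> [/\ f z \in W, f (f z) = z & e z (f z)].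
  move=> xy xW yW exy HW'.
  have card2 : #|W :\: [set x; y]| + 2 = #|W|.
    rewrite -(cardsID [set x; y] W) addnC; congr addn.
    have /setIidPr -> : [set x; y] \subset W by rewrite subUset !sub1set xW.
    by rewrite cards2 xy.
  apply: (extend_matching Hsym xy xW yW exy); apply: IH => //; first by lia.
  by move: evW; rewrite -card2; lia.
have [W0|[x0 x0W]] := set_0Vmem W.
  by exists id => x; rewrite W0 inE.
case: (boolP [exists x in W :\: U, exists y in W :\: U, (x != y) && (l x == l y)]).
  case/exists_inP=> x xWU /exists_inP[y yWU /andP[xy /eqP lxy]].
  have /setDP[xW xU] := xWU; have /setDP[yW yU] := yWU.
  apply: (step x y) => //; first exact: Hl.
  have ->: (W :\: [set x; y]) :&: U = W :&: U.
    apply/setP=> z; rewrite !inE.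
    case: (boolP (z \in U)) => zU; rewrite ?andbF ?andbT //.
    have /negPf-> : z != x by apply: contraNneq xU => <-.
    by have /negPf-> : z != y by apply: contraNneq yU => <-.
  suff ->: odd_labels U l (W :\: [set x; y]) = odd_labels U l W by [].
  apply/setP=> z; rewrite !inE.
  have [lxz|lxz] := eqVneq (l x) z.
    have: #|[set v in W :\: U | l v == z]|
        = #|[set v in (W :\: [set x; y]) :\: U | l v == z]| + 2.
      rewrite -(cardsID [set x; y] [set v in W :\: U | l v == z]) addnC; congr addn.
        by apply: eq_card => v; rewrite !inE; do !case: (_ \in _) => //=; rewrite ?andbT ?andbF.
      have /setIidPr -> : [set x; y] \subset [set v in W :\: U | l v == z].
        by rewrite subUset !sub1set !inE xW xU yW yU -lxy lxz eqxx.
      by rewrite cards2 xy.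
    by move->; rewrite oddD addbF.
  congr (odd _); apply: eq_card => v; rewrite !inE.
  case: (eqVneq v x) => [->|]; first by rewrite (negPf lxz) !andbF.
  case: (eqVneq v y) => [->|//]; first by rewrite -lxy (negPf lxz) !andbF.
move=> Hinj.
have linj : {in W :\: U &, injective l}.
  move=> x y xW yW lxy; apply: contraNeq Hinj => xy.
  by apply/exists_inP; exists x => //; apply/exists_inP; exists y => //; rewrite xy lxy /=.
have leW W' : #|odd_labels U l W'| <= #|W' :\: U|.
  by rewrite (leq_trans (subset_leq_card (odd_labels_sub U l W'))) // leq_imset_card.
have [WU0|[x xWU]] := set_0Vmem (W :\: U).
  have WU : W \subset U by rewrite -setD_eq0 WU0.
  have [W1|[y]] := set_0Vmem (W :\ x0).
    move: evW; suff ->: W = [set x0] by rewrite cards1.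
    apply/setP=> z; move/setP: W1 => /(_ z); rewrite !inE.
    by case: (eqVneq z x0) => [->|] //=.
  rewrite !inE => /andP[yx0 yW]; apply: (step x0 y) => //; first by rewrite eq_sym.
    by apply: HU => //; apply: (subsetP WU).
  apply: leq_trans (leW _) _; rewrite -[X in X <= _]addn0.
  suff ->: (W :\: [set x0; y]) :\: U = set0 by rewrite cards0.
  by apply/eqP; rewrite setD_eq0 (subset_trans _ WU) // subsetDl.
have eqodd : #|odd_labels U l W| = #|W :\: U|.
  rewrite -(card_in_imset linj); apply: eq_card => y.
  apply/idP/idP; first exact: (subsetP (odd_labels_sub U l W)).
  case/imsetP=> v vW ->; rewrite inE.
  suff ->: [set z in W :\: U | l z == l v] = [set v] by rewrite cards1.
  apply/setP=> z; rewrite in_set in_set1.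
  apply/idP/idP => [/andP[zW /eqP /(linj _ _ zW vW)->]//|/eqP->].
  by rewrite vW eqxx.
have: 0 < #|W :&: U|.
  by apply: leq_trans HW; rewrite eqodd; apply/card_gt0P; exists x.
case/card_gt0P=> u /setIP[uW uU]; have /setDP[xW xU] := xWU.
have xu : x != u by apply: contraNneq xU => ->.
apply: (step x u) => //; first by rewrite Hsym; apply: HU.
apply: leq_trans (leW _) _.
have ->: (W :\: [set x; u]) :\: U = (W :\: U) :\ x.
  apply/setP=> v; rewrite !inE.
  case: (boolP (v \in U)) => vU; rewrite ?andbF //=.
  have /negPf-> : v != u by apply: contraNneq vU => ->.
  by rewrite orbF.
have ->: (W :\: [set x; u]) :&: U = (W :&: U) :\ u.
  apply/setP=> v; rewrite !inE.
  case: (boolP (v \in U)) => vU; rewrite ?andbF ?andbT //=.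
  by have /negPf-> : v != x by apply: contraNneq xU => <-.
have := cardsD1 x (W :\: U); rewrite xWU.
have := cardsD1 u (W :&: U); rewrite inE uW uU /=.
rewrite eqodd in HW; lia.
Qed.

Section Splice.
(* [f1] and [f2] are perfect matchings of the graph [e] with one extra edge
   [ac], respectively [bd]. *)
Variables (e : rel T) (f1 f2 : T -> T) (a b c d : T).
Hypotheses (esym : symmetric e) (eirr : irreflexive e).
Hypotheses (f1K : involutive f1) (f2K : involutive f2).
Hypotheses (f1N : forall x, f1 x != x) (f2N : forall x, f2 x != x).
Hypotheses (f1a : f1 a = c) (f2b : f2 b = d).
Hypothesis (e1 : forall x, x \notin [set a; c] -> e x (f1 x)).
Hypothesis (e2 : forall x, x \notin [set b; d] -> e x (f2 x)).
Hypotheses (eab : e a b) (ebc : e b c).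

Let g x := f2 (f1 x).
Let f1I : injective f1 := inv_inj f1K.
Let f2I : injective f2 := inv_inj f2K.
Let f1c : f1 c = a. Proof. by rewrite -f1a f1K. Qed.
Let f2d : f2 d = b. Proof. by rewrite -f2b f2K. Qed.

(* The cycles of the union of the two matchings are even. *)
Let iter_neq m x : iter m g x != f2 x.
Proof.
have [k] := ubnP m; elim: k m x => // k IH [|[|m]] x Hm //=.
- by rewrite eq_sym.
- by rewrite /g; apply/negP => /eqP /f2I /eqP; apply/negP.
apply/negP => /eqP /f2I H; have/(congr1 f1) := H; rewrite f1K.
rewrite -[g (iter m g x)]/(iter m.+1 g x) iterSr => H'.
have: iter m g (g x) != f2 (g x) by apply: IH; lia.
by rewrite H' /g f2K eqxx.
Qed.

(** The two matchings alternate along the walk [d], [f1 d], [g d], ... If it closes up without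
    meeting [a] or [c], taking [f1] on its cycle and [f2] elsewhere avoids both extra edges.
    Otherwise it is cut at the first vertex [w] among [a] and [c]: [f1] before [w], the edge from
    [w] to [b], and [f2] elsewhere. *)
Lemma splice_matchings : exists f, involutive f /\ forall x, e x (f x).
Proof.
have gI : injective g by move=> x y /f2I /f1I.
case: (pickP (fun z => fconnect g d z && (z \in [set a; c]))) => [z|Hno].
  case/andP=> dz zac.
  (* Since [f1] exchanges [a] and [c], the first visit to them is at an iterate of [g], never at the
     vertex between two iterates. *)
  have Hex : exists j, iter j g d \in [set a; c].
    by exists (findex g d z); rewrite iter_findex.
  case: (ex_minnP Hex) => j wac Hmin.
  have pN i : i < j -> iter i g d \notin [set a; c].
    by move=> ij; apply: contraL ij => /Hmin; rewrite -leqNgt.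
  set w := iter j g d in wac.
  have f1ac x : (f1 x \in [set a; c]) = (x \in [set a; c]).
    rewrite !inE; apply/orP/orP => -[] /eqP.
    - by move/(congr1 f1); rewrite f1K f1a => ->; right.
    - by move/(congr1 f1); rewrite f1K f1c => ->; left.
    - by move->; rewrite f1a; right.
    - by move->; rewrite f1c; left.
  have ewb : e w b by move: wac; rewrite !inE => /orP[] /eqP->; rewrite // esym.
  have wb : w != b by apply: contraTneq ewb => ->; rewrite eirr.
  pose Y := [set x | [exists i : 'I_j, (x == iter i g d) || (x == f1 (iter i g d))]].
  have YP x : reflect (exists2 i, i < j & x = iter i g d \/ x = f1 (iter i g d)) (x \in Y).
    rewrite inE; apply: (iffP existsP) => [[i /orP Hi]|[i ij Hi]].
      by exists i => //; case: Hi => /eqP; [left|right].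
    by exists (Ordinal ij); apply/orP; case: Hi => /= ->; rewrite eqxx; [left|right].
  have Yac x : x \in Y -> x \notin [set a; c].
    by case/YP=> i /pN ac [] ->; rewrite ?f1ac.
  have wY : w \notin Y by apply/negP => /Yac; rewrite wac.
  have f1Y x : (f1 x \in Y) = (x \in Y).
    apply/YP/YP => -[i ij H]; exists i => //.
      by case: H => /(congr1 f1); rewrite !f1K; [right|left].
    by case: H => ->; rewrite ?f1K; [right|left].
  have f2f1 i : f2 (f1 (iter i g d)) = iter i.+1 g d by [].
  (* If [b] were the [f1]-partner of an iterate, the walk would return to [d] before step [j] or at
     it, and [w] would have been met earlier. *)
  have bY : b \notin Y.
    apply/negP => /YP[i ij [] H].
      by move: (iter_neq i d); rewrite -H f2d eqxx.
    have Hper : iter i.+1 g d = d by rewrite -f2f1 -H.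
    have := pN (j - i.+1); rewrite -/w => /(_ _)/negP[]; first by lia.
    by move: wac; rewrite /w -{1}(subnK ij) iterD Hper.
  have Yw i : i <= j -> (iter i g d \in Y) || (iter i g d == w).
    rewrite leq_eqVlt => /orP[/eqP->|ij]; first by rewrite eqxx orbT.
    by apply/orP; left; apply/YP; exists i => //; left.
  (* [f2] preserves this set, hence also the complement, which is where it is used. *)
  pose Y' := [set x | [|| x \in Y, x == w | x == b]].
  have f2Y' x : x \in Y' -> f2 x \in Y'.
    have f2p i : i <= j -> f2 (iter i g d) \in Y'.
      case: i => [|i] ij; first by rewrite /= f2d inE eqxx !orbT.
      by rewrite -f2f1 f2K inE f1Y; apply/orP; left; apply/YP; exists i => //; left.
    rewrite inE => /or3P[/YP[i ij [] ->]|/eqP->|/eqP->].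
    - by apply: f2p; apply: ltnW.
    - by rewrite f2f1 inE orbA Yw.
    - exact: f2p.
    - by rewrite f2b inE orbA (Yw 0).
  exists (fun x => if x \in Y then f1 x else if x == w then b else
               if x == b then w else f2 x); split=> x.
    case: (boolP (x \in Y)) => xY; first by rewrite f1Y xY f1K.
    case: (eqVneq x w) => [->|xw]; first by rewrite (negPf bY) eq_sym (negPf wb) eqxx.
    case: (eqVneq x b) => [->|xb]; first by rewrite (negPf wY) eqxx.
    have : f2 x \notin Y'.
      by apply/negP => /f2Y'; rewrite f2K inE (negPf xY) (negPf xw) (negPf xb).
    by rewrite inE !negb_or => /and3P[/negPf-> /negPf-> /negPf->]; rewrite f2K.
  case: (boolP (x \in Y)) => xY; first by apply/e1/Yac.
  case: (eqVneq x w) => [->//|xw]; case: (eqVneq x b) => [->|xb]; first by rewrite esym.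
  apply: e2; rewrite !inE negb_or xb; apply/negP => /eqP xd.
  by move: (Yw 0 (leq0n j)); rewrite /= -xd (negPf xY) (negPf xw).
have Hac x : fconnect g d x -> x \notin [set a; c].
  by move=> dx; move: (Hno x); rewrite dx => /negbT.
(* All vertices of the alternating cycle through [d]: the iterates of [g] and their
   [f2]-partners. *)
pose Y := [set x | fconnect g d x || fconnect g d (f2 x)].
have f2Y x : (f2 x \in Y) = (x \in Y) by rewrite !inE f2K orbC.
have gfc x : fconnect g d (g x) = fconnect g d x.
  by rewrite !(fconnect_sym gI d) -(same_fconnect1 gI x).
have f1Y1 x : x \in Y -> f1 x \in Y.
  rewrite !inE => /orP[dx|dx]; first by rewrite -[f2 _]/(g x) gfc dx orbT.
  by rewrite -gfc /g f1K dx.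
have f1Y x : (f1 x \in Y) = (x \in Y).
  by apply/idP/idP => /f1Y1 //; rewrite f1K.
have Yac x : x \in Y -> x \notin [set a; c].
  rewrite inE => /orP[/Hac//|dx].
  have := Hac (f1 x); rewrite -gfc /g f1K => /(_ dx); apply: contra.
  by rewrite !inE => /orP[] /eqP->; rewrite ?f1a ?f1c eqxx ?orbT.
have dY : d \in Y by rewrite inE connect0.
have bY : b \in Y by rewrite -f2Y f2b.
exists (fun x => if x \in Y then f1 x else f2 x); split=> x.
  by case: (boolP (x \in Y)) => xY; rewrite ?f1Y ?f2Y ?xY ?(negPf xY) ?f1K ?f2K.
case: ifPn => xY; first by apply/e1/Yac.
by apply: e2; rewrite !inE; apply/norP; split; apply: contraNneq xY => ->.
Qed.
End Splice.

Definition add_edge e a c : rel T :=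
  fun x y => e x y || ([set x; y] == [set a; c]).

Lemma add_edgeP e a c x y : x != y ->
  add_edge e a c x y -> [\/ e x y, x = a /\ y = c | x = c /\ y = a].
Proof.
move=> xy /orP[|/eqP/(set2_eq xy)[[-> ->]|[-> ->]]]; first by constructor 1.
  by constructor 2.
by constructor 3.
Qed.

Definition barrier e U l :=
  (forall x y, x \notin U -> y \notin U -> e x y -> l x = l y) /\
  #|U| < #|odd_labels U l [set: T]|.

Definition perfect_matching e f := involutive f /\ forall x, e x (f x).

Definition nonedges e := [set p : T * T | (p.1 != p.2) && ~~ e p.1 p.2].

(** Lovasz's argument, by induction on the number of nonedges. [U] consists of the vertices adjacent
    to all others. If adjacency is transitive through vertices outside [U], the classes are cliques
    and [clique_matching] decides. Otherwise there are edges [ab], [bc] with [ac] missing, and some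
    [d] not adjacent to [b]; perfect matchings that use the added edge [ac], respectively [bd], are
    spliced. *)
Lemma tutte e : symmetric e -> irreflexive e -> ~~ odd #|T| ->
  (exists f, perfect_matching e f) \/ (exists U l, barrier e U l).
Proof.
move=> Hsym Hirr evT; have [m] := ubnP #|nonedges e|.
elim: m e Hsym Hirr => // m IH e Hsym Hirr Hm.
pose U := [set u | [forall x, (x != u) ==> e u x]].
case: (pickP (fun p : T * T * T => [&& p.1.2 \notin U, e p.1.1 p.1.2, e p.1.2 p.2,
    p.1.1 != p.2 & ~~ e p.1.1 p.2])) => [[[a b] c]|Htr].
  case/and5P=> /= bU eab ebc ac Neac.
  have [d db Nebd] : exists2 d, d != b & ~~ e b d.
    move: bU; rewrite inE negb_forall => /existsP[d].
    by rewrite negb_imply => /andP[]; exists d.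
  (* A barrier of the graph with one more edge is a barrier of [e], so only a perfect matching
     through the new edge is of interest. *)
  have enlarge x y : x != y -> ~~ e x y ->
      (exists f, perfect_matching (add_edge e x y) f /\
         (f x = y \/ perfect_matching e f)) \/
      (exists U l, barrier e U l).
    move=> xy Nexy.
    have Esym : symmetric (fun u v => (u != v) && add_edge e x y u v).
      by move=> u v; rewrite /add_edge Hsym (setUC [set u]) eq_sym.
    have [||[f [fK Hf]]|[U' [l [Hl HU']]]] := IH _ Esym.
    - by move=> u; rewrite eqxx.
    - apply: leq_trans (_ : #|nonedges e| <= m) => //.
      apply: proper_card; apply/properP; split.
        apply/subsetP=> -[u v]; rewrite !inE /= /add_edge => /andP[uv].
        by rewrite uv /= negb_or => /andP[].
      by exists (x, y); rewrite !inE /= /add_edge xy ?eqxx ?orbT.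
    - left; exists f; split.
        by split=> // z; case/andP: (Hf z).
      have [->|fx] := eqVneq (f x) y; [by left|right; split=> // z].
      have /andP[zf /(add_edgeP zf)[//|[zx fz]|[zy fz]]] := Hf z.
        by rewrite -zx fz eqxx in fx.
      by rewrite -zy -fz fK eqxx in fx.
    - right; exists U', l; split=> // u v uU vU uv; apply: Hl => //.
      by rewrite /add_edge uv orTb andbT; apply: contraTneq uv => ->; rewrite Hirr.
  have [[f1 [[f1K Hf1] [f1a|]]]|] := enlarge a c ac Neac; last by right.
    2: by left; exists f1.
  have [|[f2 [[f2K Hf2] [f2b|]]]|] := enlarge b d _ Nebd.
  - by rewrite eq_sym.
  - left.
    have f1N x : f1 x != x.
      apply/eqP => H; have := Hf1 x; rewrite H /add_edge Hirr /= => /eqP/setP E.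
      have := E a; have := E c; rewrite !inE !eqxx orbT !orbb /=.
      by move=> /eqP ca /eqP aa; move: ac; rewrite aa ca eqxx.
    have f2N x : f2 x != x.
      apply/eqP => H; have := Hf2 x; rewrite H /add_edge Hirr /= => /eqP/setP E.
      have := E b; have := E d; rewrite !inE !eqxx orbT !orbb /=.
      by move=> /eqP ca /eqP aa; move: db; rewrite aa ca eqxx.
    apply: (@splice_matchings e f1 f2 a b c d) => //.
    + move=> x; rewrite !inE negb_or => /andP[xa xc].
      have := f1N x; rewrite eq_sym => xf.
      by case: (add_edgeP xf (Hf1 x)) => // -[E _]; rewrite E eqxx in xa xc.
    + move=> x; rewrite !inE negb_or => /andP[xa xc].
      have := f2N x; rewrite eq_sym => xf.
      by case: (add_edgeP xf (Hf2 x)) => // -[E _]; rewrite E eqxx in xa xc.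
  - by left; exists f2.
  - by right.
(* By [Htr] the closed neighbourhoods outside [U] are equivalence classes there, and [l] picks a
   representative of each. *)
pose l x := odflt x [pick y | (y \notin U) && ((y == x) || e x y)].
have tr x y z : y \notin U -> e x y -> e y z -> x != z -> e x z.
  by move=> yU xy yz xz; move: (Htr (x, y, z)); rewrite /= yU xy yz xz => /negbFE.
have lE x y : x \notin U -> y \notin U -> e x y -> l x = l y.
  move=> xU yU xy; rewrite /l.
  have E : (fun z => (z \notin U) && ((z == x) || e x z))
       =1 (fun z => (z \notin U) && ((z == y) || e y z)).
    move=> z; congr andb; apply/idP/idP => /orP[/eqP->|H].
    - by rewrite Hsym xy orbT.
    - by have [//|zy] := eqVneq z y; rewrite (tr y x z) // 1?Hsym // eq_sym.
    - by rewrite xy orbT.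
    - by have [//|zx] := eqVneq z x; rewrite (tr x y z) // eq_sym.
  rewrite (eq_pick E); case: pickP => // /(_ y).
  by rewrite yU eqxx.
have [HU|HU] := leqP #|odd_labels U l [set: T]| #|U|.
  left; have [|x y xU yU xy lxy|||f Hf] := @clique_matching e U l [set: T] Hsym.
  - by move=> u x; rewrite inE => /forallP/(_ x)/implyP.
  - have lP v : v \notin U -> (l v \notin U) /\ (l v = v \/ e v (l v)).
      move=> vU; rewrite /l; case: pickP => [z /andP[zU /orP[/eqP->|vz]]|/(_ v)].
      + by split=> //; left.
      + by split=> //; right.
      + by rewrite vU eqxx.
    have [lxU [lx|ex]] := lP x xU; have [lyU [ly|ey]] := lP y yU.
    + by rewrite -lx -ly lxy eqxx in xy.
    + by rewrite Hsym -lx lxy.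
    + by rewrite -ly -lxy.
    + by apply: (tr x (l x) y) => //; rewrite lxy Hsym.
  - by rewrite cardsT.
  - by rewrite setTI.
  exists f; split=> x; first by case: (Hf x (in_setT x)).
  by case: (Hf x (in_setT x)).
by right; exists U, l; split=> // x y xU yU; apply: lE.
Qed.

End Tutte.

(* For [#|T|] odd, apply the even case to [option T], where the new vertex
   is adjacent to all others. *)
Lemma tutte_near (T : finType) (e : rel T) : symmetric e -> irreflexive e ->
  (exists f : T -> T, [/\ involutive f, forall x, f x != x -> e x (f x) &
      #|[set x | f x == x]| <= 1]) \/
  (exists (U : {set T}) (l : T -> option T),
     (forall x y, x \notin U -> y \notin U -> e x y -> l x = l y) /\
     #|U|.+1 < #|l @: ~: U|).
Proof.
move=> Hsym Hirr; have [oT|evT] := boolP (odd #|T|); last first.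
  have [[f [fK Hf]]|[U [l [Hl HU]]]] := tutte Hsym Hirr evT.
    left; exists f; split=> //.
    have -> : [set x | f x == x] = set0; last by rewrite cards0.
    apply/setP=> x; rewrite !inE; apply: contraTF (Hf x) => /eqP->.
    by rewrite Hirr.
  right; exists U, (Some \o l); split=> [x y xU yU xy|]; first by rewrite /= (Hl x y).
  rewrite imset_comp (card_imset _ (@Some_inj _)).
  have := subset_leq_card (odd_labels_sub U l [set: T]).
  rewrite setTD => Hle; apply: leq_trans Hle.
  (* For [#|T|] even, [#|U|] and the number of odd labels have the same parity, so the strict
     inequality improves by one. *)
  have := odd_card_labels U l [set: T]; rewrite setTD.
  have := cardsC U; move: HU evT; lia.
pose e' (x y : option T) :=
  match x, y with Some x, Some y => e x y | None, None => false | _, _ => true end.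
have esym : symmetric e' by case=> [x|] [y|] //=.
have eirr : irreflexive e' by case=> [x|] //=.
have evO : ~~ odd #|{: option T}| by rewrite card_option /= oT.
have [[f [fK Hf]]|[U [l [Hl HU]]]] := tutte esym eirr evO.
  have [r fN] : exists r, f None = Some r.
    by case E: (f None) => [r|]; [exists r|have := Hf None; rewrite E].
  have fr : f (Some r) = None by rewrite -fN fK.
  pose h x := odflt x (f (Some x)).
  have fh x : x != r -> f (Some x) = Some (h x).
    rewrite /h => xr; case E: (f (Some x)) => [y|]; first by [].
    have := congr1 f E; rewrite fK fN => -[xr']; by rewrite xr' eqxx in xr.
  have hr : h r = r by rewrite /h fr.
  have eh x : x != r -> e x (h x) by move=> xr; have := Hf (Some x); rewrite fh.
  left; exists h; split.
  - move=> x; have [->|xr] := eqVneq x r; first by rewrite !hr.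
    have H : f (Some (h x)) = Some x by rewrite -fh // fK.
    by rewrite {1}/h H.
  - move=> x; have [->|xr _] := eqVneq x r; first by rewrite hr eqxx.
    exact: eh.
  - rewrite -(cards1 r); apply: subset_leq_card; apply/subsetP=> x.
    rewrite !inE => /eqP hx; apply: contraTT isT => /eh.
    by rewrite hx Hirr.
(* Otherwise all vertices outside [U] share the label of [None], so [U] is empty and there is
   exactly one odd label, against the even number of vertices. *)
have NU : None \in U.
  apply: contraTT HU => NU; rewrite -leqNgt.
  have lN x : x \notin U -> l x = l None.
    by case: x => // x xU; apply: Hl.
  set N := #|odd_labels U l _|.
  have : N <= 1.
    rewrite -(cards1 (l None)); apply: leq_trans (subset_leq_card (odd_labels_sub _ _ _)) _.
    apply: subset_leq_card; apply/subsetP=> y /imsetP[x].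
    by rewrite setTD !inE => /lN -> ->.
  have : odd N = odd #|_ :\: U| := odd_card_labels U l _.
  rewrite setTD; rewrite -(cardsC U) oddD in evO.
  by case: #|U| evO => [|u] /=; lia.
right; exists [set x | Some x \in U], (fun x => l (Some x)); split.
  by move=> x y; rewrite !inE => xU yU xy; apply: Hl.
have -> : #|[set x | Some x \in U]|.+1 = #|U|.
  rewrite (cardsD1 None) NU add1n; congr _.+1.
  rewrite -(card_imset _ (@Some_inj _)); apply: eq_card => -[x|].
    by rewrite (mem_imset _ _ (@Some_inj _)) !inE.
  by rewrite !inE eqxx /=; apply/imsetP => -[].
apply: leq_trans HU _; apply: leq_trans (subset_leq_card (odd_labels_sub _ _ _)) _.
apply: subset_leq_card; rewrite setTD; apply/subsetP=> y /imsetP[[x|]].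
  by move=> xU ->; apply/imsetP; exists x => //; rewrite !inE in xU *.
by rewrite inE NU.
Qed.

(** * Integer k-matchings as matchings of a blow-up *)

Section Blowup.
Variables (T : finType) (k : nat) (V : {set T}) (Es : {set {set T}}).
Hypothesis k_gt0 : 0 < k.

Let W := {x : T | x \in V}.
Let P := (W * 'I_k)%type.

Let adj (p q : P) := (val p.1 != val q.1) && ([set val p.1; val q.1] \in Es).

Section Project.
Variable f : P -> P.
Hypotheses (fK : involutive f) (fadj : forall p, f p != p -> adj p (f p)).
Let edge (p : P) : {set T} := [set val p.1; val (f p).1].
Let over (e : {set T}) : {set P} := [set p | (f p != p) && (edge p == e)].
Let h : {ffun {set T} -> 'I_k.+1} := [ffun e => inord (#|over e|./2)].

Let card_fibre (w : W) : #|[set p : P | p.1 == w]| = k.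
Proof.
rewrite (_ : [set p | _] = setX [set w] setT) ?cardsX ?cards1 ?cardsT ?card_ord ?mul1n //.
by apply/setP=> p; rewrite !inE andbT.
Qed.

(** [f] exchanges the copies over [e] at its two ends, so exactly half of them lie at [w]. In
    particular half is at most [k], and [inord] does not truncate. *)
Let h_over (e : {set T}) (w : W) : val w \in e -> (h e : nat) = #|[set p in over e | p.1 == w]|.
Proof.
move=> we; rewrite ffunE.
have inj : injective f := inv_inj fK.
have E : over e :\: [set p | p.1 == w] = f @: [set p in over e | p.1 == w].
  apply/setP=> p; rewrite -{2}[p]fK (mem_imset _ _ inj) !inE.
  have -> : edge (f p) = edge p by rewrite /edge fK setUC.
  rewrite fK eq_sym andbC; case: eqVneq => //= pN; case: eqP => //= pe.
  move: we; rewrite -pe !inE !(inj_eq val_inj) ![w == _]eq_sym.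
  have /andP[] : adj p (f p) by exact: fadj.
  rewrite (inj_eq val_inj) => + _.
  by case: (eqVneq p.1 w) => [<-|_] /=; [rewrite eq_sym => /negPf-> | move=> _ ->].
have cE : #|over e| = #|[set p in over e | p.1 == w]|.*2.
  rewrite -(cardsID [set p | p.1 == w] (over e)) E (card_imset _ inj) -addnn.
  by congr (_ + _); apply: eq_card => p; rewrite !inE.
rewrite cE doubleK inordK // ltnS -[X in _ <= X](card_fibre w).
by apply/subset_leq_card/subsetP=> p; rewrite !inE => /andP[_].
Qed.

Let hdegE (w : W) : hdeg Es h (val w) + #|[set p | (f p == p) && (p.1 == w)]| = k.
Proof.
rewrite -[RHS](card_fibre w) addnC -(cardsID [set p | f p == p] [set p : P | p.1 == w]).
congr (_ + _); first by apply: eq_card => p; rewrite !inE andbC.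
rewrite /hdeg -[RHS]sum1_card.
rewrite (partition_big edge (fun e => (e \in Es) && (val w \in e))) /=.
  apply: eq_bigr => e /andP[eE we]; rewrite (h_over we) -sum1_card.
  by apply: eq_bigl => p; rewrite !inE andbAC.
move=> p; rewrite !inE => /andP[/fadj/andP[_ pE] /eqP<-].
by rewrite pE eqxx.
Qed.

Lemma kmatching_of_blowup : #|[set p | f p == p]| <= 1 ->
  has_perfect_or_almost_perfect k V Es.
Proof.
rewrite leq_eqVlt => /orP[/cards1P[p0 fix0]|]; last first.
  rewrite ltnS leqn0 cards_eq0 => /eqP fix0.
  apply/existsP; exists h; apply/orP; left; apply/forall_inP => v vV.
  have /= H := hdegE (exist _ v vV); apply/eqP; rewrite -[RHS]H.
  rewrite -[LHS]addn0; congr (_ + _); apply/esym/eqP; rewrite cards_eq0; apply/eqP/setP=> p.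
  by move/setP: fix0 => /(_ p); rewrite !inE => ->.
have fixE p : (f p == p) = (p == p0) by move/setP: fix0 => /(_ p); rewrite !inE.
have deg0 : hdeg Es h (val p0.1) = k.-1.
  have := hdegE p0.1; rewrite (_ : [set p | _ && _] = [set p0]) ?cards1 ?addn1.
    by move=> H; apply: succn_inj; rewrite prednK.
  by apply/setP=> p; rewrite !inE fixE; case: eqP => [->|]; rewrite ?eqxx.
have degN v : v \in V -> v != val p0.1 -> hdeg Es h v = k.
  move=> vV vp; have /= H := hdegE (exist _ v vV); rewrite -[RHS]H.
  rewrite (_ : [set p | _] = set0) ?cards0 ?addn0 //.
  apply/setP=> p; rewrite !inE fixE; apply/negbTE; apply: contra vp.
  by case/andP=> /eqP-> /eqP->.
apply/existsP; exists h; apply/orP; right; apply/and3P; split.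
- apply/forall_inP => v vV; have [->|/(degN _ vV)-> //] := eqVneq v (val p0.1).
  by rewrite deg0 leq_pred.
- apply/cards1P; exists (val p0.1); apply/setP=> v; rewrite !inE.
  have [->|vp] := eqVneq v (val p0.1); first by rewrite deg0 eqxx (valP p0.1).
  by apply/negbTE/negP => /andP[vV]; rewrite (degN _ vV vp); lia.
- apply/forall_inP => v vV; have [->|/(degN _ vV)->] := eqVneq v (val p0.1).
    by rewrite deg0 eqxx orbT.
  by rewrite eqxx.
Qed.
End Project.

(* Tutte's theorem for the graph in which every vertex is replaced by [k]
   independent copies: its matchings are the integer [k]-matchings. *)
Lemma kmatching_or_barrier :
  has_perfect_or_almost_perfect k V Es \/
  exists (S I : {set T}) (L : finType) (lab : T -> L),
  [/\ S \subset V, I \subset V :\: S,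
      forall u v, u \in I -> v \in V :\: S -> u != v -> [set u; v] \notin Es,
      forall u v, u \in V :\: S :\: I -> v \in V :\: S :\: I -> u != v ->
        [set u; v] \in Es -> lab u = lab v &
      k * #|S| + 1 < k * #|I| + #|lab @: (V :\: S :\: I)|].
Proof.
have adj_sym : symmetric adj by move=> p q; rewrite /adj eq_sym setUC.
have adj_irr : irreflexive adj by move=> p; rewrite /adj eqxx.
have [[f [fK Hf]]|[U [l [Hl HU]]]] := tutte_near adj_sym adj_irr.
  by move=> Hfix; left; apply: (kmatching_of_blowup fK Hf Hfix).
right.
(* A vertex enters the barrier only with all of its copies, which gives [k * #|S0| <= #|U|]; any
   other vertex keeps a copy outside [U], chosen by [phi]. *)
pose S0 := [set w : W | [forall i, (w, i) \in U]].
pose I0 := [set w : W | (w \notin S0) &&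
  [forall w' : W, (w' \notin S0) ==> (val w != val w') ==> ([set val w; val w'] \notin Es)]].
pose phi (w : W) := odflt (Ordinal k_gt0) [pick i | (w, i) \notin U].
pose lab x := if insub x is Some w then l (w, phi w) else None.
have phiU w : w \notin S0 -> (w, phi w) \notin U.
  rewrite inE negb_forall => /existsP[i iU]; rewrite /phi.
  by case: pickP => [//|/(_ i)]; rewrite iU.
have labE w : lab (val w) = l (w, phi w) by rewrite /lab valK.
have memS w : (val w \in val @: S0) = (w \in S0) by apply: mem_imset; apply: val_inj.
have memI w : (val w \in val @: I0) = (w \in I0) by apply: mem_imset; apply: val_inj.
have valE x : x \in V -> exists w : W, x = val w by move=> xV; exists (exist _ x xV).
exists (val @: S0), (val @: I0), _, lab; split.
- by apply/subsetP=> x /imsetP[w _ ->]; apply: valP.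
- apply/subsetP=> x /imsetP[w wI ->]; rewrite inE memS (valP w) andbT.
  by move: wI; rewrite inE => /andP[].
- move=> u v /imsetP[w wI ->] /setDP[/valE[w' ->]]; rewrite memS => w'S ww'.
  by move: wI; rewrite inE => /andP[_ /forallP/(_ w')]; rewrite w'S ww'.
- move=> u v /setDP[/setDP[/valE[w ->]]]; rewrite memS memI => wS _.
  case/setDP=> /setDP[/valE[w' ->]]; rewrite memS memI => wS' _ ww' E.
  by rewrite !labE; apply: Hl; rewrite ?phiU // /adj ww'.
rewrite !(card_imset _ val_inj).
have HS : k * #|S0| <= #|U|.
  rewrite mulnC -[X in _ * X](card_ord k) -[X in _ * X]cardsT -cardsX.
  by apply/subset_leq_card/subsetP=> -[w i]; rewrite !inE andbT => /forallP.
have HI : #|l @: setX I0 setT| <= k * #|I0|.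
  by apply: leq_trans (leq_imset_card _ _) _; rewrite cardsX cardsT card_ord mulnC.
suff : #|l @: ~: U| <= #|l @: setX I0 setT| + #|lab @: (V :\: val @: S0 :\: val @: I0)|.
  move/(leq_trans HU) => H; rewrite addn1.
  by apply: leq_trans (leq_trans H (leq_add HI (leqnn _))); rewrite !ltnS.
apply: leq_trans (leq_card_setU _ _); apply/subset_leq_card/subsetP=> y.
case/imsetP=> -[w i]; rewrite inE => wiU ->; rewrite inE.
have wS : w \notin S0 by apply: contra wiU; rewrite inE => /forallP.
have [wI|wI] := boolP (w \in I0).
  by apply/orP; left; apply: imset_f; rewrite !inE in wI *; rewrite wI.
apply/orP; right; suff ->: l (w, i) = lab (val w).
  by apply: imset_f; rewrite !in_setD memS memI wS wI (valP w).
(* All copies of [w] outside [U] are adjacent to the chosen copy of [w'], hence share one label.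
   Only isolated vertices may carry up to [k] labels, which is why they are counted with weight
   [k]. *)
move: wI; rewrite inE wS /= negb_forall => /existsP[w'].
rewrite !negb_imply andbT => /and3P[w'S ww' E].
have lw j : (w, j) \notin U -> l (w, j) = l (w', phi w').
  by move=> jU; apply: Hl; rewrite ?phiU // /adj ww'.
by rewrite labE !lw ?phiU.
Qed.
End Blowup.

(** * Cells and slices of the arrangement graph *)

(* [lia] does not identify cardinals that differ by a [reverse_coercion]. *)
Ltac ord_lia := unfold reverse_coercion in *; lia.

Lemma card_setCU (T : finType) (A B : {set T}) x : x \in A -> x \in B ->
  #|T|.+1 - #|A| - #|B| <= #|~: (A :|: B)|.
Proof.
move=> xA xB; have : 0 < #|A :&: B| by apply/card_gt0P; exists x; rewrite inE xA.
by have := cardsC (A :|: B); have := cardsUI A B; lia.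
Qed.

Section Arrangement.
Variables n s : nat.
Notation V := (arr_vertex n s).
Notation t := (n - s).
Implicit Types (f g u v w : V) (i j : 'I_s) (a b c : 'I_n) (P : {set 'I_s}).
Implicit Types (K Z B : {set V}).

Lemma arrI f : injective (val f).
Proof. exact/injectiveP/(valP f). Qed.

Lemma swap_value_inj f i c :
  injectiveb [ffun j => tperm (val f i) c (val f j)].
Proof. by apply/injectiveP=> x y; rewrite !ffunE => /perm_inj/arrI. Qed.

(* Exchanges the values [f i] and [c]; when [c] is not used by [f] this is the
   move to a neighbour of [f] in position [i]. *)
Definition set_value f i c : V :=
  exist (fun h : {ffun _} => injectiveb h) _ (swap_value_inj f i c).

Lemma set_valueE f i c j : val (set_value f i c) j = tperm (val f i) c (val f j).
Proof. by rewrite ffunE. Qed.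

Lemma set_value_at f i c : val (set_value f i c) i = c.
Proof. by rewrite set_valueE tpermL. Qed.

Lemma set_value_other f i c j : j != i -> val f j != c -> val (set_value f i c) j = val f j.
Proof.
move=> ji jc; rewrite set_valueE tpermD // eq_sym //.
by rewrite (inj_eq (@arrI f)).
Qed.

Definition image_of f : {set 'I_n} := [set val f j | j : 'I_s].

Lemma card_image_of f : #|image_of f| = s.
Proof. by rewrite card_imset ?card_ord //; apply: arrI. Qed.

Lemma mem_image_of f j : val f j \in image_of f.
Proof. exact: imset_f. Qed.

Lemma notin_image_of f c j : c \notin image_of f -> val f j != c.
Proof. by apply: contraNneq => <-; apply: mem_image_of. Qed.

Definition adj_at i u v := (val u i != val v i) && [forall j, (j != i) ==> (val u j == val v j)].

Lemma adj_atP i u v :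
  reflect (val u i != val v i /\ forall j, j != i -> val u j = val v j) (adj_at i u v).
Proof.
apply: (iffP andP) => -[-> H]; split=> //.
  by move=> j ji; move/forallP/(_ j): H; rewrite ji => /eqP.
by apply/forallP=> j; apply/implyP => /H->.
Qed.

Lemma arr_adjP u v : reflect (exists i, adj_at i u v) (arr_adj u v).
Proof.
apply: (iffP cards1P) => -[i H]; exists i.
  apply/adj_atP; split=> [|j ji]; first by move/setP/(_ i): H; rewrite !inE eqxx.
  by move/setP/(_ j): H; rewrite !inE (negPf ji) => /negbFE/eqP.
move/adj_atP: H => [ui uj]; apply/setP=> j; rewrite !inE.
by have [->|/uj->] := eqVneq j i; rewrite ?ui ?eqxx.
Qed.

Lemma adj_at_sym i u v : adj_at i u v = adj_at i v u.
Proof. by apply/adj_atP/adj_atP => -[H1 H2]; split=> [|j /H2->]; rewrite // eq_sym. Qed.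

Lemma adj_sym u v : arr_adj u v = arr_adj v u.
Proof. by apply/arr_adjP/arr_adjP => -[i]; exists i; rewrite adj_at_sym. Qed.

Lemma adj_neq u v : arr_adj u v -> u != v.
Proof. by case/arr_adjP=> i /adj_atP[ui _]; apply: contraNneq ui => ->. Qed.

Lemma adj_at_set_value f i c : c \notin image_of f -> adj_at i f (set_value f i c).
Proof.
move=> cf; apply/adj_atP; rewrite set_value_at notin_image_of //; split=> // j ji.
by rewrite set_value_other // notin_image_of.
Qed.

Lemma eq_arr u v : (forall j, val u j = val v j) -> u = v.
Proof. by move=> H; apply/val_inj/ffunP. Qed.

Lemma set_valueK f i c : set_value (set_value f i c) i (val f i) = f.
Proof. by apply: eq_arr => j; rewrite set_valueE set_value_at set_valueE tpermC tpermK. Qed.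

(** With the positions outside [P] frozen, this is a copy of the arrangement graph with [#|P|]
    positions and [#|P| + t] values, of degree [#|P| * t]. *)
Definition cell P g : {set V} := [set f : V | [forall j, (j \notin P) ==> (val f j == val g j)]].

Lemma cellP P g f : reflect (forall j, j \notin P -> val f j = val g j) (f \in cell P g).
Proof.
rewrite inE; apply: (iffP forallP) => H j; last by apply/implyP=> /H->.
by move=> jP; apply/eqP; apply: (implyP (H j)).
Qed.

Definition allowed P g : {set 'I_n} := ~: [set val g j | j in ~: P].

Lemma card_allowed P g : s <= n -> #|allowed P g| = #|P| + t.
Proof.
move=> sn; have := cardsC [set val g j | j in ~: P]; rewrite card_ord.
rewrite card_imset; last exact: arrI.
have := cardsC P; rewrite card_ord /allowed; ord_lia.
Qed.

Lemma allowedP P g c : reflect (forall j, j \notin P -> val g j != c) (c \in allowed P g).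
Proof.
rewrite inE; apply: (iffP idP) => [H j jP|H].
  by apply: contraNneq H => <-; apply: imset_f; rewrite inE.
by apply/imsetP => -[j]; rewrite inE => /H/eqP Hj E; apply: Hj.
Qed.

Lemma allowed_cell P g f : f \in cell P g -> allowed P f = allowed P g.
Proof.
move=> /cellP fg; apply/setP=> c; apply/allowedP/allowedP => H j jP.
  by rewrite -fg ?H.
by rewrite fg ?H.
Qed.

Lemma allowed_val P g f j : f \in cell P g -> j \in P -> val f j \in allowed P g.
Proof.
move=> fK jP; rewrite -(allowed_cell fK); apply/allowedP => j' j'P.
by rewrite (inj_eq (@arrI f)); apply: contraNneq j'P => ->.
Qed.

Lemma allowed_image_of P g f c : f \in cell P g -> c \notin image_of f -> c \in allowed P g.
Proof.
by move=> fK cf; rewrite -(allowed_cell fK); apply/allowedP => j _; apply: notin_image_of.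
Qed.

Lemma set_value_cell P g f i c :
  f \in cell P g -> i \in P -> c \in allowed P g -> set_value f i c \in cell P g.
Proof.
move=> fK iP; rewrite -(allowed_cell fK) => /allowedP cA; apply/cellP => j jP.
rewrite set_value_other ?cA //; first by apply: (cellP _ _ _ fK).
by apply: contraNneq jP => ->.
Qed.

Lemma cell_refl P g : g \in cell P g.
Proof. exact/cellP. Qed.

Lemma cell_eq P g g' : g' \in cell P g -> cell P g' = cell P g.
Proof.
move=> /cellP gg; apply/setP=> f; apply/cellP/cellP => H j jP; first by rewrite H ?gg.
by rewrite H // gg.
Qed.

Definition slice K i a : {set V} := [set f in K | val f i == a].

Lemma slice_cell P g i g' : i \in P -> g' \in cell P g ->
  slice (cell P g) i (val g' i) = cell (P :\ i) g'.
Proof.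
move=> iP gK; rewrite -(cell_eq gK); apply/setP=> f; rewrite [LHS]inE.
apply/andP/cellP => [[/cellP H /eqP fi] j|H].
  by rewrite !inE negb_and negbK => /orP[/eqP->|/H].
split; last by rewrite H // !inE eqxx.
by apply/cellP=> j jP; apply: H; rewrite !inE negb_and jP orbT.
Qed.

(* The cost of separating [Z] from [B] inside [K] by deleting vertices, coded
   as pairs (x, x), and edges, coded as pairs in Z x B. *)
Definition separator K Z B : {set V * V} :=
  [set p | ((p.1 == p.2) && (p.1 \in K :\: (Z :|: B)))
        || [&& p.1 \in Z, p.2 \in B & arr_adj p.1 p.2]].

Lemma separator_sym K Z B : #|separator K Z B| = #|separator K B Z|.
Proof.
have sI : injective (fun p : V * V => (p.2, p.1)) by move=> [x y] [x' y'] [-> ->].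
rewrite -(card_imset _ sI); apply: eq_card => -[x y].
rewrite -[(x, y)]/((fun p : V * V => (p.2, p.1)) (y, x)) (mem_imset _ _ sI) !inE /=.
congr orb; last by rewrite adj_sym andbCA.
by rewrite eq_sym; case: eqVneq => //= ->; rewrite orbC.
Qed.

(* An edge [uv] with [u] not in [B] and [v] not in [Z] contributes an element
   to the cost: a deleted end or the edge itself. *)
Definition block Z B u v : V * V :=
  if u \notin Z then (u, u) else if v \notin B then (v, v) else (u, v).

Lemma block_in K Z B u v : u \in K -> v \in K -> u \notin B -> v \notin Z ->
  arr_adj u v -> block Z B u v \in separator K Z B.
Proof.
move=> uK vK uB vZ uv; rewrite /block.
have [uZ|uZ] := boolP (u \in Z); last by rewrite inE /= eqxx !inE (negPf uZ) (negPf uB) uK.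
have [vB|vB] := boolP (v \in B); last by rewrite inE /= eqxx !inE (negPf vZ) (negPf vB) vK.
by rewrite inE /= uZ vB uv orbT.
Qed.

Lemma block_cases Z B u v :
  [\/ block Z B u v = (u, u), block Z B u v = (v, v) | block Z B u v = (u, v)].
Proof.
rewrite /block; case: ifP => _; first by constructor 1.
by case: ifP => _; [constructor 2|constructor 3].
Qed.

(** Each component of [block] is an end of the edge, and both ends agree off position [i]; the value
    at [i] is known to be [a]. *)
Lemma block_inj Z B i a u v u' v' : adj_at i u v -> adj_at i u' v' ->
  val u i = a -> val u' i = a -> block Z B u v = block Z B u' v' -> u = u'.
Proof.
move=> /adj_atP[_ uv] /adj_atP[_ uv'] ua ua' E.
have off (x y : V) j : (forall j, j != i -> val x j = val y j) -> j != i ->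
    val (block Z B x y).1 j = val x j.
  by move=> xy ji; case: (block_cases Z B x y) => -> //=; rewrite xy.
apply: eq_arr => j; have [->|ji] := eqVneq j i; first by rewrite ua ua'.
by rewrite -(off u v) // E off.
Qed.

(** Disjoint sets of values give disjoint parts of the cost, so bounds obtained in different slices
    add up. *)
Definition separator_in K Z B i (A : {set 'I_n}) :=
  [set p in separator K Z B | (val p.1 i \in A) && (val p.2 i \in A)].

Lemma separator_in_le K Z B i (A : {set 'I_n}) : #|separator_in K Z B i A| <= #|separator K Z B|.
Proof. by apply/subset_leq_card/subsetP=> p; rewrite inE => /andP[]. Qed.

Lemma separator_in_add K Z B i (A A' : {set 'I_n}) : [disjoint A & A'] ->
  #|separator_in K Z B i A| + #|separator_in K Z B i A'| <= #|separator_in K Z B i (A :|: A')|.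
Proof.
move=> dA; rewrite -cardsUI.
have -> : separator_in K Z B i A :&: separator_in K Z B i A' = set0.
  apply/setP=> p; rewrite !in_set; apply/negbTE/negP.
  case/andP=> /andP[_ /andP[pA _]] /andP[_ /andP[pA' _]].
  by move/disjointFr: dA => /(_ _ pA); rewrite pA'.
rewrite cards0 addn0; apply/subset_leq_card/subsetP=> p; rewrite !in_set.
by case/orP=> /andP[-> /andP[-> ->]]; rewrite ?orbT.
Qed.

Lemma separator_in_slice K Z B i a : Z \subset K -> B \subset K ->
  #|separator (slice K i a) (Z :&: slice K i a) (B :&: slice K i a)| <= #|separator_in K Z B i [set a]|.
Proof.
move=> ZK BK; apply/subset_leq_card/subsetP=> -[x y]; rewrite inE /=.
case/orP=> [/andP[/eqP<- /setDP[/setIdP[xK xa] xN]]|/and3P[/setIP[xZ /setIdP[xK xa]] /setIP[yB /setIdP[_ ya]] xy]].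
  rewrite inE; apply/andP; split; last by rewrite !in_set1; apply/andP.
  rewrite inE /= eqxx; apply/orP; left; apply/setDP; split=> //.
  by apply: contra xN => /setUP[] H; apply/setUP; [left|right]; apply/setIP; split=> //; apply/setIdP.
rewrite inE; apply/andP; split; last by rewrite !in_set1; apply/andP.
by rewrite inE /= xZ yB xy orbT.
Qed.

Lemma exists_other P i : i \in P -> 1 < #|P| -> exists2 j, j \in P & j != i.
Proof.
move=> iP P2; have : 0 < #|P :\ i| by have := cardsD1 i P; rewrite iP; ord_lia.
by case/card_gt0P=> j; rewrite !inE => /andP[]; exists j.
Qed.

Lemma exists_other2 P i : i \in P -> 2 < #|P| ->
  exists j l, [/\ j \in P, j != i, l \in P, l != i & l != j].
Proof.
move=> iP P3; have [|j jP ji] := exists_other iP; first by ord_lia.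
have : 0 < #|P :\ i :\ j|.
  have jPi : j \in P :\ i by rewrite !inE ji jP.
  by have := cardsD1 i P; have := cardsD1 j (P :\ i); rewrite iP jPi; ord_lia.
by case/card_gt0P=> l; rewrite !inE => /and3P[lj li lP]; exists j, l.
Qed.

(** * Sizes of slices and the edges that leave them *)

Section Counting.
Hypothesis sn : s < n.

Lemma unused f (A : {set 'I_n}) : #|A| < t -> exists2 c, c \notin image_of f & c \notin A.
Proof.
move=> At; have : 0 < #|~: (image_of f :|: A)|.
  have := cardsC (image_of f :|: A); have := cardsUI (image_of f) A; rewrite card_image_of card_ord; ord_lia.
by case/card_gt0P=> c; rewrite !inE negb_or => /andP[]; exists c.
Qed.

(** For [A = [set b]] with [b] different from [a], these are the vertices of the slice of [a] that
    reach the slice of [b] by changing position [i] alone. *)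
Definition slice_avoiding K i a (A : {set 'I_n}) := [set f in slice K i a | [disjoint image_of f & A]].

Lemma slice_avoidingP K i a (A : {set 'I_n}) f :
  reflect [/\ f \in K, val f i = a & forall j, val f j \notin A] (f \in slice_avoiding K i a A).
Proof.
rewrite !inE -andbA; apply: (iffP and3P) => -[fK fa H]; split=> //.
- exact/eqP.
- by move=> j; rewrite (disjointFr H) ?mem_image_of.
- exact/eqP.
- by rewrite disjoint_subset; apply/subsetP=> c /imsetP[j _ ->]; apply: H.
Qed.

Lemma set_value_slice_avoiding P g i a A f j c : j \in P -> j != i ->
  f \in slice_avoiding (cell P g) i a A -> c \in allowed P g :\: (a |: A) ->
  set_value f j c \in slice_avoiding (cell P g) i a A.
Proof.
move=> jP ji /slice_avoidingP[fK fa fA] /setDP[cP cN].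
have [ca cA] : c != a /\ c \notin A.
  by move: cN; rewrite in_setU1 negb_or => /andP[].
apply/slice_avoidingP; split.
- exact: set_value_cell.
- by rewrite set_value_other ?fa // eq_sym.
- move=> l; have [->|lj] := eqVneq l j; first by rewrite set_value_at.
  have [lc|lc] := eqVneq (val f l) c; last by rewrite set_value_other.
  by rewrite set_valueE lc tpermR.
Qed.

Lemma card_slice_avoiding1 P g i j a A f : j \in P -> j != i ->
  f \in slice_avoiding (cell P g) i a A ->
  #|allowed P g :\: (a |: A)| <= #|slice_avoiding (cell P g) i a A|.
Proof.
move=> jP ji fR.
have inj : injective (set_value f j) by move=> c c' E; rewrite -(set_value_at f j c) E set_value_at.
rewrite -(card_imset _ inj); apply/subset_leq_card/subsetP=> h /imsetP[c cA ->].
exact: set_value_slice_avoiding.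
Qed.

Lemma card_offdiag (T : finType) (A : {set T}) :
  #|[set p in setX A A | p.1 != p.2]| = #|A| * #|A|.-1.
Proof.
have := cardsID [set p : T * T | p.1 == p.2] (setX A A).
have -> : setX A A :&: [set p | p.1 == p.2] = (fun x => (x, x)) @: A.
  apply/setP=> -[x y]; rewrite !inE; apply/andP/imsetP => [[/andP[xA _] /eqP /= <-]|[z zA [-> ->]]].
    by exists x.
  by rewrite zA eqxx.
rewrite card_imset => [|x y [] //]; rewrite cardsX.
have -> : setX A A :\: [set p | p.1 == p.2] = [set p in setX A A | p.1 != p.2].
  by apply/setP=> p; rewrite !inE andbC.
by case: #|A| => [|m] /=; nia.
Qed.

(** Two exchanges prescribe any two distinct values at [j] and [l], and these values distinguish the
    resulting vertices. *)
Lemma card_slice_avoiding2 P g i j l a A f : j \in P -> j != i -> l \in P -> l != i -> l != j ->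
  f \in slice_avoiding (cell P g) i a A ->
  let N := #|allowed P g :\: (a |: A)| in N * N.-1 <= #|slice_avoiding (cell P g) i a A|.
Proof.
move=> jP ji lP li lj fR /=; rewrite -card_offdiag.
pose h (p : 'I_n * 'I_n) := set_value (set_value f j p.1) l p.2.
have hl p : val (h p) l = p.2 by rewrite set_value_at.
have hj p : p.1 != p.2 -> val (h p) j = p.1.
  by move=> p12; rewrite set_value_other ?set_value_at // eq_sym.
rewrite -(@card_in_imset _ _ h).
  apply/subset_leq_card/subsetP=> x /imsetP[[c c']]; rewrite in_set in_setX => /andP[/andP[cA cA'] _] ->.
  by do 2!apply: set_value_slice_avoiding => //.
move=> [c c'] [b b']; rewrite !in_set => /andP[_ cc] /andP[_ bb] E.
by have := hl (c, c'); have := hj (c, c') cc; rewrite E hl hj //= => -> ->.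
Qed.

Lemma slice_avoiding_witness P g i a b f : a != b -> f \in cell P g -> val f i = a -> b \in allowed P g ->
  exists h, h \in slice_avoiding (cell P g) i a [set b].
Proof.
move=> ab fK fa bA.
have [bf|bf] := boolP (b \in image_of f); last first.
  exists f; apply/slice_avoidingP; split=> // j; rewrite inE; exact: notin_image_of.
have [|c cf _] := @unused f set0; first by rewrite cards0; ord_lia.
case/imsetP: bf => l _ bl.
have lP : l \in P.
  by apply: contraT => lP; move/allowedP: bA => /(_ l lP); rewrite -(cellP _ _ _ fK) // bl eqxx.
have li : i != l by apply: contraNneq ab => il; rewrite -fa bl il.
exists (set_value f l c); apply/slice_avoidingP; split.
- by apply: set_value_cell => //; apply: allowed_image_of cf.
- by rewrite set_value_other ?notin_image_of.
- move=> j; rewrite inE; have [->|jl] := eqVneq j l.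
    by rewrite set_value_at eq_sym bl notin_image_of.
  rewrite set_value_other //; last exact: notin_image_of.
  by rewrite bl; apply: contraNneq jl => /arrI->.
Qed.

Lemma card_allowed2 P g a b : a \in allowed P g -> b \in allowed P g -> a != b ->
  #|allowed P g :\: (a |: [set b])| = #|P| + t - 2.
Proof.
move=> aA bA ab; rewrite -(card_allowed P g) ?(ltnW sn) //.
rewrite -(cardsID [set a; b] (allowed P g)).
have /setIidPr -> : [set a; b] \subset allowed P g by rewrite subUset !sub1set aA.
by rewrite cards2 ab /=; ord_lia.
Qed.

Section Direction.
Variables (P : {set 'I_s}) (g : V) (i : 'I_s).
Hypothesis iP : i \in P.
Notation K := (cell P g).

(** Every vertex of the slice of [a] not using [b] has an edge into the slice of [b], and [block]
    charges these edges injectively. Excluding [a] and [b] leaves [#|P| + t - 2] values: one further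
    free position gives that many vertices, two give ordered pairs of distinct values. *)
Lemma cross_cost Z B a b z w : a != b ->
  [disjoint slice K i a & B] -> [disjoint slice K i b & Z] ->
  z \in slice K i a -> w \in slice K i b ->
  (1 < #|P| -> #|P| + t - 2 <= #|separator_in K Z B i [set a; b]|) /\
  (2 < #|P| -> (#|P| + t - 2) * (#|P| + t - 3) <= #|separator_in K Z B i [set a; b]|).
Proof.
move=> ab dB dZ; rewrite !inE -!/(cell P g) => /andP[zK /eqP za] /andP[wK /eqP wb].
have {}zK : z \in K by rewrite inE.
have {}wK : w \in K by rewrite inE.
have bA : b \in allowed P g by rewrite -wb; apply: allowed_val.
have aA : a \in allowed P g by rewrite -za; apply: allowed_val.
have [h hR] := slice_avoiding_witness ab zK za bA.
have Rle : #|slice_avoiding K i a [set b]| <= #|separator_in K Z B i [set a; b]|.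
  pose phi f := block Z B f (set_value f i b).
  have nbR f : f \in slice_avoiding K i a [set b] -> adj_at i f (set_value f i b).
    case/slice_avoidingP=> fK fa fb; apply: adj_at_set_value; apply/imsetP => -[j _ bj].
    by have := fb j; rewrite bj inE eqxx.
  rewrite -(@card_in_imset _ _ phi) => [|f f' fR fR' E]; last first.
    have [_ fa _] := slice_avoidingP _ _ _ _ _ fR; have [_ fa' _] := slice_avoidingP _ _ _ _ _ fR'.
    exact: (block_inj (nbR _ fR) (nbR _ fR') fa fa' E).
  apply/subset_leq_card/subsetP=> p /imsetP[f fR ->].
  have fnb := nbR f fR; have [fK fa fb] := slice_avoidingP _ _ _ _ _ fR.
  have fs : f \in slice K i a by rewrite inE fK fa eqxx.
  have ms : set_value f i b \in slice K i b by rewrite inE set_value_cell // set_value_at eqxx.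
  rewrite inE; apply/andP; split; last first.
    by rewrite /phi; case: (block_cases Z B f (set_value f i b)) => ->;
      rewrite ?set_value_at ?fa !inE !eqxx ?orbT.
  apply: block_in => //.
  - by apply: set_value_cell.
  - by rewrite (disjointFr dB fs).
  - by rewrite (disjointFr dZ ms).
  - by apply/arr_adjP; exists i.
have cA := card_allowed2 aA bA ab.
split=> HP.
  have [j jP ji] := exists_other iP HP; rewrite -cA.
  exact: leq_trans (card_slice_avoiding1 jP ji hR) Rle.
have [j [l [jP ji lP li lj]]] := exists_other2 iP HP.
apply: leq_trans Rle; apply: leq_trans (card_slice_avoiding2 jP ji lP li lj hR).
by rewrite cA; apply: leq_mul => //; rewrite -subn1 -subnDA.
Qed.

Lemma card_slice_ge f : 2 < #|P| -> f \in K ->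
  (#|P| + t - 1) * (#|P| + t - 2) <= #|slice K i (val f i)|.
Proof.
move=> HP fK; have [j [l [jP ji lP li lj]]] := exists_other2 iP HP.
have fR : f \in slice_avoiding K i (val f i) set0 by apply/slice_avoidingP; split=> // x; rewrite inE.
have /= := card_slice_avoiding2 jP ji lP li lj fR.
have -> : allowed P g :\: (val f i |: set0) = allowed P g :\ val f i.
  by rewrite setU0.
have := cardsD1 (val f i) (allowed P g); rewrite allowed_val // card_allowed ?(ltnW sn) // => E.
have -> : #|allowed P g :\ val f i| = #|P| + t - 1 by rewrite E add1n subn1.
have -> : (#|P| + t - 1).-1 = #|P| + t - 2 by rewrite -subn1 -subnDA.
move/leq_trans; apply; apply/subset_leq_card/subsetP=> x /slice_avoidingP[xK xi _].
by rewrite inE xK xi eqxx.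
Qed.

(** Each vertex of the slice has an edge in direction [i] that leaves the slice, hence leaves [Z];
    as the slice misses [B], each such edge is blocked. *)
Lemma slice_cost Z B a : (forall f, f \in Z -> val f i = a) ->
  [disjoint slice K i a & B] -> #|slice K i a| <= #|separator K Z B|.
Proof.
move=> Za dB.
pose c f := odflt (val f i) [pick c | c \notin image_of f].
have cP f : c f \notin image_of f.
  rewrite /c; case: pickP => //= Hno.
  by have [|x xf _] := @unused f set0; [rewrite cards0; ord_lia|rewrite Hno in xf].
pose phi f := block Z B f (set_value f i (c f)).
rewrite -(@card_in_imset _ _ phi) => [|f f' fs fs' E]; last first.
  move: fs fs'; rewrite !inE => /andP[_ /eqP fa] /andP[_ /eqP fa'].
  exact: (block_inj (adj_at_set_value _ (cP _)) (adj_at_set_value _ (cP _)) fa fa' E).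
apply/subset_leq_card/subsetP=> p /imsetP[f fs ->].
have /setIdP[fK /eqP fa] := fs.
apply: block_in => //.
- by apply: set_value_cell => //; apply: allowed_image_of (cP f).
- by rewrite (disjointFr dB fs).
- apply/negP => /Za; rewrite set_value_at -fa => E.
  by have := notin_image_of i (cP f); rewrite E eqxx.
- by apply/arr_adjP; exists i; apply: adj_at_set_value.
Qed.

(** A vertex of [B] with value [a] at [i] has at least [t.+1 - #|A|] neighbours in direction [i]
    with value outside [A]; the extra one arises because [a] lies both in [A] and among the values
    already used. Such a neighbour is not in [B], so it is deleted or its edge is. These charges
    begin with a vertex whose value is outside [A], hence do not meet [separator_in]. *)
Lemma side_cost Z B a (A : {set 'I_n}) : B \subset K -> a \in A ->
  (forall f, f \in B -> val f i \in A) ->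
  #|slice B i a| * (t.+1 - #|A|) + #|separator_in K Z B i A| <= #|separator K Z B|.
Proof.
move=> BK aA BA.
pose D := [set p : V * 'I_n | [&& p.1 \in slice B i a, p.2 \notin image_of p.1 & p.2 \notin A]].
pose phi (p : V * 'I_n) := let u := set_value p.1 i p.2 in if u \in Z then (u, p.1) else (u, u).
have phi1 p : (phi p).1 = set_value p.1 i p.2 by rewrite /phi; case: ifP.
have Dge : #|slice B i a| * (t.+1 - #|A|) <= #|D|.
  rewrite -[#|D|]sum1_card (partition_big fst (mem (slice B i a))) /=; last first.
    by move=> p; rewrite inE => /and3P[].
  rewrite -sum_nat_const; apply: leq_sum => v vB; rewrite sum1_card.
  have -> : #|[pred p in D | p.1 == v]| = #|~: (image_of v :|: A)|.
    have inj : injective (pair v : 'I_n -> V * 'I_n) by move=> x y [].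
    rewrite -(card_imset _ inj); apply: eq_card => -[x c]; rewrite !inE /=.
    apply/andP/imsetP => [[/and3P[_ H1 H2] /eqP xv]|[c' + [-> ->]]].
      by rewrite -xv; exists c => //; rewrite !inE negb_or H1.
    rewrite !inE negb_or => /andP[-> ->]; rewrite eqxx; split=> //.
    by move: vB; rewrite !inE => ->.
  have aim : a \in image_of v by move: vB; rewrite inE => /andP[_ /eqP<-]; apply: mem_image_of.
  rewrite -subSn ?(ltnW sn) // -(card_image_of v) -[X in X.+1](card_ord n).
  exact: card_setCU aim aA.
apply: leq_trans (leq_add Dge (leqnn _)) _.
rewrite -(@card_in_imset _ _ phi); last first.
  move=> [v c] [v' c']; rewrite !inE /= => /andP[/andP[_ /eqP va] _] /andP[/andP[_ /eqP va'] _].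
  move/(congr1 fst); rewrite !phi1 /= => E.
  have cc : c = c' by rewrite -(set_value_at v i c) E set_value_at.
  by rewrite -(set_valueK v i c) va E -va' set_valueK cc.
rewrite -cardsUI.
have -> : phi @: D :&: separator_in K Z B i A = set0.
  apply/setP=> p; rewrite !in_set; apply/negbTE/negP => /andP[/imsetP[[v c] vcD ->]].
  rewrite phi1 set_value_at /= => /andP[_ /andP[cA _]].
  by move: vcD; rewrite inE /= cA !andbF.
rewrite cards0 addn0; apply/subset_leq_card; rewrite subUset; apply/andP; split; last first.
  by apply/subsetP=> p; rewrite inE => /andP[].
apply/subsetP=> p /imsetP[[v c]]; rewrite inE /= => /and3P[/setIdP[vB /eqP va] cv cA] ->.
have vK := subsetP BK _ vB.
have uK : set_value v i c \in K by apply: set_value_cell => //; apply: allowed_image_of cv.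
have uB : set_value v i c \notin B by apply/negP => /BA; rewrite set_value_at (negPf cA).
rewrite /phi /=; have [uZ|uZ] := boolP (set_value v i c \in Z).
  rewrite inE /= uZ vB adj_sym; apply/orP; right; apply/arr_adjP; exists i; exact: adj_at_set_value.
by rewrite in_set /= eqxx in_setD uK in_setU (negPf uZ) (negPf uB).
Qed.

End Direction.
End Counting.
End Arrangement.

(** * Separating two vertex sets *)

Lemma side_arith p r x y : 1 < p -> 0 < x -> 0 < y ->
  p * r <= x * (p.-1 * r) + y * (r.+1 - x).
Proof.
case: p x y => [|[|p]] // [|[|x]] // [|y] // _ _ _.
  by rewrite mul1n subSS subn0 /=; nia.
by rewrite !mulSn /=; nia.
Qed.

Lemma mid_arith p r x : 1 < p -> 0 < x -> p * r <= x * (p.-1 * r) + (p + r - 2).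
Proof. by case: p x => [|[|p]] // [|x] // _ _; rewrite /= !mulSn; nia. Qed.

Lemma side_arith2 p r q x m : 1 < r -> 2 < p -> 0 < q <= 2 -> 0 < x -> m <= q * x -> m <= p * r - 1 ->
  p * r - 1 + m <= q * (p.-1 * r) + x * (r.+1 - q).
Proof.
case: p => // p; case: q => [|[|[|q]]] // r1 p2 _.
  case: x => // x _; case: r r1 => // r r1; rewrite subSS subn0 /= !mulSn mul0n !addn0.
  by nia.
rewrite subSS /= => _ mx mp; have [r3|r3] := leqP 3 r; first by nia.
have r2 : r = 2 by lia.
by subst r; lia.
Qed.

Section Separation.
Variables n s : nat.
Hypothesis s2n : s.+1 < n.
Notation V := (arr_vertex n s).
Notation t := (n - s).
Implicit Types (f g u v w : V) (i j : 'I_s) (a b c : 'I_n) (P : {set 'I_s}).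
Implicit Types (K Z B : {set V}).

Let sn : s < n := ltnW s2n.

Let t2 : 1 < t. Proof. by rewrite ltn_subRL addn1. Qed.

Definition vals i Z : {set 'I_n} := (fun f : V => val f i) @: Z.

Lemma mem_vals i Z f : f \in Z -> val f i \in vals i Z.
Proof. exact: imset_f. Qed.

Definition separated K Z B := [&& Z \subset K, B \subset K & [disjoint Z & B]].

Lemma separated_sym K Z B : separated K Z B -> separated K B Z.
Proof. by case/and3P=> ZK BK dZB; apply/and3P; split=> //; rewrite disjoint_sym. Qed.

Section Direction.
Variables (P : {set 'I_s}) (g : V) (i : 'I_s).
Hypothesis iP : i \in P.
Hypothesis IH : forall g' Z B, separated (cell (P :\ i) g') Z B ->
  Z != set0 -> B != set0 -> #|P|.-1 * t <= #|separator (cell (P :\ i) g') Z B|.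
Notation K := (cell P g).
(** The degree inside a slice of the cell, not the degree of the whole graph. *)
Notation "''d'" := (#|P|.-1 * t).

Definition mids Z B := vals i Z :&: vals i B.

(** Each slice met by both sets is a cell with one free position less, so [IH] applies to it, and
    different slices pay separately. *)
Lemma mid_cost Z B (A : {set 'I_n}) : separated K Z B -> A \subset mids Z B ->
  #|A| * 'd <= #|separator_in K Z B i A|.
Proof.
case/and3P=> ZK BK dZB.
have [m] := ubnP #|A|; elim: m A => // m IHm A Am AM.
have [->|[a aA]] := set_0Vmem A; first by rewrite cards0.
rewrite (cardsD1 a) aA mulSn; have EA := setD1K aA.
have Hm : #|A :\ a| * 'd <= #|separator_in K Z B i (A :\ a)|.
  apply: IHm; last exact: subset_trans (subsetDl _ _) AM.
  by move: Am; rewrite (cardsD1 a) aA add1n ltnS.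
have dA : [disjoint [set a] & A :\ a] by rewrite disjoints1 !inE eqxx.
rewrite -{2}EA; apply: leq_trans (separator_in_add K Z B i dA); apply: leq_add => //.
have /setIP[/imsetP[z zZ az] /imsetP[w wB aw]] := subsetP AM _ aA.
apply: leq_trans (separator_in_slice i a ZK BK).
have zs : z \in slice K i a by apply/setIdP; split; [apply: (subsetP ZK)|rewrite az].
have ws : w \in slice K i a by apply/setIdP; split; [apply: (subsetP BK)|rewrite aw].
rewrite az slice_cell ?(subsetP ZK) // in zs ws *; apply: IH.
- rewrite /separated !subsetIr /=.
  by apply: disjointWl (subsetIl _ _) (disjointWr (subsetIl _ _) dZB).
- by apply/set0Pn; exists z; rewrite inE zZ.
- by apply/set0Pn; exists w; rewrite inE wB.
Qed.

Lemma one_sided_cost Z B a : separated K Z B -> vals i B \subset vals i Z ->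
  a \in vals i B ->
  #|vals i B| * 'd + #|slice B i a| * (t.+1 - #|vals i B|) <= #|separator K Z B|.
Proof.
move=> sep sub aB; have /and3P[ZK BK _] := sep.
have Hm : #|vals i B| * 'd <= #|separator_in K Z B i (vals i B)|.
  by apply: mid_cost => //; rewrite subsetI sub /=.
apply: leq_trans (leq_add Hm (leqnn _)) _.
rewrite addnC; apply: (side_cost sn iP) => // f.
exact: mem_vals.
Qed.

Lemma pure_slice B c : c \notin vals i B -> [disjoint slice K i c & B].
Proof.
move=> cB; rewrite disjoint_subset; apply/subsetP=> f /setIdP[_ /eqP fc].
by rewrite inE; apply: contra cB => /(mem_vals i); rewrite fc.
Qed.

Lemma vals_cross_cost Z B a b : separated K Z B ->
  a \in vals i Z :\: vals i B -> b \in vals i B :\: vals i Z ->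
  (1 < #|P| -> #|P| + t - 2 <= #|separator_in K Z B i [set a; b]|) /\
  (2 < #|P| -> (#|P| + t - 2) * (#|P| + t - 3) <= #|separator_in K Z B i [set a; b]|).
Proof.
case/and3P=> ZK BK _ /setDP[/imsetP[z zZ az] aB] /setDP[/imsetP[w wB bw] bZ].
apply: (@cross_cost _ _ sn P g i iP Z B a b z w).
- by apply: contraNneq aB => ->; rewrite bw mem_vals.
- exact: pure_slice.
- exact: pure_slice.
- by apply/setIdP; split; [apply: (subsetP ZK)|rewrite az].
- by apply/setIdP; split; [apply: (subsetP BK)|rewrite bw].
Qed.

Lemma disjoint_mids Z B a b : a \in vals i Z :\: vals i B ->
  b \in vals i B :\: vals i Z -> [disjoint mids Z B & [set a; b]].
Proof.
move=> /setDP[_ aB] /setDP[_ bZ]; rewrite disjoint_sym disjoint_subset.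
apply/subsetP=> x; rewrite !inE => /orP[] /eqP->; first by rewrite (negPf aB) andbF.
by rewrite (negPf bZ).
Qed.

(** One common slice is short of the goal by [t]. The rest comes from the edges towards slices
    without [B] (or without [Z]), or else from a pair of slices each met by only one of the sets. *)
Lemma mid_step Z B : separated K Z B -> 1 < #|P| -> mids Z B != set0 ->
  #|P| * t <= #|separator K Z B|.
Proof.
move=> sep P2 /set0Pn[m mM].
have Mcost := mid_cost sep (subxx _).
have Mle := leq_trans Mcost (separator_in_le _ _ _ _ _).
have M0 : 0 < #|mids Z B| by apply/card_gt0P; exists m.
have side Z' B' : separated K Z' B' -> mids Z' B' != set0 -> vals i B' \subset vals i Z' ->
    #|P| * t <= #|separator K Z' B'|.
  move=> sep' /set0Pn[a /setIP[_ aB]] sub.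
  apply: leq_trans (one_sided_cost sep' sub aB).
  have : 0 < #|slice B' i a|.
    have /imsetP[f fB E] := aB; apply/card_gt0P; exists f.
    by rewrite inE fB E eqxx.
  have : 0 < #|vals i B'| by apply/card_gt0P; exists a.
  by move=> x0 y0; apply: side_arith.
have [sub|nsub] := boolP (vals i B \subset vals i Z).
  by apply: side => //; apply/set0Pn; exists m.
have [sub|nsub'] := boolP (vals i Z \subset vals i B).
  rewrite separator_sym; apply: side => //; first exact: separated_sym.
  by apply/set0Pn; exists m; rewrite /mids setIC.
have [b bB bZ] := subsetPn nsub; have [a aZ aB] := subsetPn nsub'.
have aD : a \in vals i Z :\: vals i B by rewrite inE aZ aB.
have bD : b \in vals i B :\: vals i Z by rewrite inE bB bZ.
have [/(_ P2) Hc _] := vals_cross_cost sep aD bD.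
have := leq_trans (separator_in_add K Z B i (disjoint_mids aD bD)) (separator_in_le _ _ _ _ _).
by apply: leq_trans; apply: leq_trans (leq_add Mcost Hc); apply: mid_arith.
Qed.

End Direction.

(* The cliques of the graph are the cells with one free position. *)
Lemma clique_cost (P : {set 'I_s}) g Z B : #|P| = 1 -> separated (cell P g) Z B ->
  Z != set0 -> B != set0 -> t <= #|separator (cell P g) Z B|.
Proof.
move=> P1 /and3P[ZK BK dZB] /set0Pn[z zZ] /set0Pn[b bB].
have [i Pi] : exists i, P = [set i] by apply/cards1P; rewrite P1.
have iP : i \in P by rewrite Pi set11.
have cardK : t.+1 <= #|cell P g|.
  have inj : injective (set_value g i) by move=> c c' E; rewrite -(set_value_at g i c) E set_value_at.
  have := card_allowed P g (ltnW sn); rewrite P1 add1n => <-.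
  rewrite -(card_imset _ inj); apply/subset_leq_card/subsetP=> f /imsetP[c cA ->].
  by apply: set_value_cell => //; apply: cell_refl.
have adjK u v : u \in cell P g -> v \in cell P g -> u != v -> arr_adj u v.
  move=> /cellP uK /cellP vK uv; apply/arr_adjP; exists i.
  have off j : j != i -> val u j = val v j.
    by move=> ji; rewrite uK ?vK // Pi inE.
  apply/adj_atP; split=> //; apply: contraNneq uv => uvi; apply/eqP/eq_arr => j.
  by have [->|/off] := eqVneq j i.
(* Fixing [z] and [b], each of the at least [t] vertices other than [b] is charged: its edge to [b]
   if it is in [Z], its edge to [z] if it is in [B], itself otherwise. *)
pose phi f := if f \in Z then (f, b) else if f \in B then (z, f) else (f, f).
have bK := subsetP BK _ bB.
have bZ : b \notin Z by rewrite (disjointFl dZB bB).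
apply: (@leq_trans #|cell P g :\ b|).
  by have := cardsD1 b (cell P g); rewrite bK; move: cardK; rewrite add1n => + E; rewrite E.
rewrite -(@card_in_imset _ _ phi).
  apply/subset_leq_card/subsetP=> p /imsetP[f /setD1P[fb fK] ->].
  rewrite /phi; case: ifPn => fZ; first by rewrite inE /= fZ bB adjK ?orbT.
  case: ifPn => fB; last by rewrite in_set /= eqxx in_setD fK in_setU (negPf fZ) (negPf fB).
  rewrite inE /= zZ fB adjK ?orbT //; first exact: (subsetP ZK).
  by apply: contraNneq fZ => <-.
move=> f f' /setD1P[fb _] /setD1P[fb' _]; rewrite /phi.
have [fZ|fZ] := boolP (f \in Z); have [fZ'|fZ'] := boolP (f' \in Z).
- by case.
- by case: ifPn => fB' [_ E]; rewrite -E eqxx in fb'.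
- by case: ifPn => fB [_ E]; rewrite E eqxx in fb.
- by case: (boolP (f \in B)) => fB; case: (boolP (f' \in B)) => fB'; case.
Qed.

(** [r.+2] is the number of available values, [x] and [y] are the sizes of [R] and [C], and [x1],
    [x2] count off-diagonal points of the two rectangles; a rectangle meets the diagonal in at most
    its shorter side. The bound is attained at [x = y = 1]. *)
Lemma grid_arith (r x y x1 x2 : nat) : 0 < r ->
  0 < x <= r.+1 -> 0 < y <= r.+1 ->
  x * (r.+2 - y) <= x1 + minn x (r.+2 - y) ->
  y * (r.+2 - x) <= x2 + minn y (r.+2 - x) -> 2 * r <= x1 + x2.
Proof.
move=> r0 /andP[x0 xr] /andP[y0 yr].
have [x' [Ex x'0]] : exists x', r.+2 = x + x' /\ 0 < x' by exists (r.+2 - x); lia.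
have [y' [Ey y'0]] : exists y', r.+2 = y + y' /\ 0 < y' by exists (r.+2 - y); lia.
have -> : r.+2 - y = y' by lia.
have -> : r.+2 - x = x' by lia.
case: (leqP x y') => xy.
  have yx : y <= x' by lia.
  rewrite (minn_idPl yx) => H1 H2.
  case: y' Ey y'0 xy H1 => // -[|y'] Ey _ xy H1.
    have ? : x = 1 by lia. 
    have ? : x' = r.+1 by lia.
    have ? : y = r.+1 by lia.
    subst; nia.
  case: x' Ex x'0 yx H2 => // -[|x'] Ex _ yx H2.
    have ? : y = 1 by lia.
    have ? : x = r.+1 by lia.
    have ? : y' = r.-1 by lia.
    subst; nia.
  nia.
have yx : x' <= y by lia.
rewrite (minn_idPr yx) => H1 H2.
case: x Ex x0 xr xy H1 => // -[|x] Ex _ xr xy H1; first by lia.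
case: y Ey y0 yr yx H2 => // -[|y] Ey _ yr yx H2; first by lia.
nia.
Qed.

(* With [R], [C] the values of [Z] in the two positions, the off-diagonal points
   of the grid in R x C^c and R^c x C lie neither in [Z] nor in [B]. *)
Lemma grid_cost (P : {set 'I_s}) g i j Z B : P = [set i; j] -> i != j ->
  separated (cell P g) Z B -> Z != set0 -> B != set0 ->
  [disjoint vals i Z & vals i B] -> [disjoint vals j Z & vals j B] ->
  2 * t <= #|separator (cell P g) Z B|.
Proof.
move=> EP ij /and3P[ZK BK dZB] /set0Pn[z zZ] /set0Pn[b bB] di dj.
have iP : i \in P by rewrite EP set21.
have jP : j \in P by rewrite EP set22.
have cardA : #|allowed P g| = t.+2.
  by rewrite card_allowed ?(ltnW sn) // EP cards2 ij.
pose X := cell P g :\: (Z :|: B).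
have XC : #|X| <= #|separator (cell P g) Z B|.
  have inj : injective (fun f : V => (f, f)) by move=> f f' [].
  rewrite -(card_imset _ inj); apply/subset_leq_card/subsetP=> p /imsetP[f fX ->].
  by rewrite inE /= eqxx fX.
apply: leq_trans XC.
pose A := allowed P g; pose R := vals i Z; pose C := vals j Z.
have RA : R \subset A.
  by apply/subsetP=> r /imsetP[f fZ ->]; apply: allowed_val => //; apply: (subsetP ZK).
have CA : C \subset A.
  by apply/subsetP=> r /imsetP[f fZ ->]; apply: allowed_val => //; apply: (subsetP ZK).
pose X1 := [set p in setX R (A :\: C) | p.1 != p.2].
pose X2 := [set p in setX (A :\: R) C | p.1 != p.2].
have offdiag (S S' : {set 'I_n}) :
    #|S| * #|S'| <= #|[set p in setX S S' | p.1 != p.2]| + minn #|S| #|S'|.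
  rewrite -cardsX -(cardsID [set p | p.1 == p.2] (setX S S')) addnC; apply: leq_add.
    by apply/subset_leq_card/subsetP=> p; rewrite !inE andbC.
  have D : setX S S' :&: [set p | p.1 == p.2] \subset (fun x => (x, x)) @: (S :&: S').
    apply/subsetP=> -[x y]; rewrite !inE => /andP[/andP[xS yS] /eqP /= E].
    by apply/imsetP; exists x; rewrite ?inE ?xS E ?yS.
  rewrite leq_min; apply/andP; split; apply: leq_trans (subset_leq_card D) _;
    apply: leq_trans (leq_imset_card _ _) _; apply: subset_leq_card.
    exact: subsetIl.
  exact: subsetIr.
(* Off the diagonal the second exchange does not disturb the value placed at [i], so [p] is
   recovered from [pt p]. *)
pose pt (p : 'I_n * 'I_n) := set_value (set_value g i p.1) j p.2.
have ptK p : p.1 \in A -> p.2 \in A -> pt p \in cell P g.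
  by move=> p1 p2; do 2!apply: set_value_cell => //; apply: cell_refl.
have pti p : p.1 != p.2 -> val (pt p) i = p.1.
  by move=> p12; rewrite set_value_other ?set_value_at.
have ptj p : val (pt p) j = p.2 by rewrite set_value_at.
have XP (S S' : {set 'I_n}) p : p \in setX S S' -> p.1 \in S /\ p.2 \in S'.
  by case: p => x y /setXP.
have ptX : pt @: (X1 :|: X2) \subset X.
  apply/subsetP=> f /imsetP[p + ->]; case/setUP=> /setIdP[/XP[p1 p2] p12].
    have p1A := subsetP RA _ p1; have /setDP[p2A p2C] := p2.
    apply/setDP; split; first exact: ptK.
    apply/negP => /setUP[/(mem_vals j)|/(mem_vals i)]; first by rewrite ptj (negPf p2C).
    by rewrite pti // (disjointFr di p1).
  have p2A := subsetP CA _ p2; have /setDP[p1A p1R] := p1.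
  apply/setDP; split; first exact: ptK.
  apply/negP => /setUP[/(mem_vals i)|/(mem_vals j)]; first by rewrite pti // (negPf p1R).
  by rewrite ptj // (disjointFr dj p2).
have Xle : #|X1| + #|X2| <= #|X|.
  apply: leq_trans (subset_leq_card ptX); rewrite card_in_imset; last first.
    move=> p q pX qX E.
    have p12 : p.1 != p.2 by case/setUP: pX => /setIdP[].
    have q12 : q.1 != q.2 by case/setUP: qX => /setIdP[].
    rewrite [p]surjective_pairing [q]surjective_pairing.
    by rewrite -(pti _ p12) -(ptj p) E pti // ptj.
  rewrite -cardsUI (_ : X1 :&: X2 = set0) ?cards0 ?addn0 //.
  apply/setP=> p; rewrite in_set0; apply/negP => /setIP[/setIdP[/XP[p1 _] _]].
  by case/setIdP=> /XP[/setDP[_ /negP]].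
have cD (S : {set 'I_n}) : S \subset A -> #|A :\: S| = t.+2 - #|S|.
  by move=> SA; rewrite cardsD (setIidPr SA) cardA.
have card_pos k : k \in P -> 0 < #|vals k Z| <= t.+1.
  move=> kP; apply/andP; split; first by apply/card_gt0P; exists (val z k); apply: mem_vals.
  have sub : vals k Z \subset A :\ val b k.
    apply/subsetP=> r rZ; apply/setD1P; split.
      apply: contraTneq rZ => ->; have bk := mem_vals k bB.
      have [E|E] : k = i \/ k = j by move: kP; rewrite EP => /set2P[]; [left|right].
        by rewrite E in bk *; rewrite (disjointFl di bk).
      by rewrite E in bk *; rewrite (disjointFl dj bk).
    by have /imsetP[f fZ ->] := rZ; apply: allowed_val => //; apply: (subsetP ZK).
  apply: leq_trans (subset_leq_card sub) _.
  have := cardsD1 (val b k) A; rewrite cardA allowed_val //; last exact: (subsetP BK).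
  by rewrite add1n => -[<-].
apply: leq_trans Xle; apply: (@grid_arith t #|R| #|C|) => //.
- exact: ltnW t2.
- exact: card_pos.
- exact: card_pos.
- by rewrite -cD //; apply: offdiag.
- by rewrite mulnC minnC -cD //; apply: offdiag.
Qed.

Theorem cell_cost P g Z B : separated (cell P g) Z B -> Z != set0 -> B != set0 ->
  #|P| * t <= #|separator (cell P g) Z B|.
Proof.
have [m] := ubnP #|P|; elim: m P g Z B => // m IHm P g Z B Pm sep Z0 B0.
have [P0|P0] := posnP #|P|; first by rewrite P0.
have [P1|P1] := eqVneq #|P| 1; first by rewrite P1 mul1n; apply: clique_cost.
have P2 : 1 < #|P| by case: #|P| P0 P1 => [|[]].
have cardD i : i \in P -> #|P :\ i| = #|P|.-1.
  by move=> iP; rewrite (cardsD1 i P) iP.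
have IHi i : i \in P -> forall g' Z B, separated (cell (P :\ i) g') Z B ->
    Z != set0 -> B != set0 -> #|P|.-1 * t <= #|separator (cell (P :\ i) g') Z B|.
  move=> iP g' Z' B' sep' Z0' B0'; rewrite -(cardD i iP); apply: IHm => //.
  by rewrite cardD // prednK.
have [/exists_inP[i iP Mi]|] := boolP [exists i in P, mids i Z B != set0].
  exact: mid_step iP (IHi i iP) _ _ sep P2 Mi.
rewrite negb_exists_in => /forall_inP pure.
have dis i : i \in P -> [disjoint vals i Z & vals i B].
  by move=> /pure; rewrite negbK setI_eq0.
have /card_gt0P[i iP] := P0.
have /set0Pn[z zZ] := Z0; have /set0Pn[b bB] := B0.
have [P3|P3] := ltnP 2 #|P|.
  have [] := @vals_cross_cost P g i iP Z B (val z i) (val b i) sep.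
  - by apply/setDP; rewrite (disjointFr (dis i iP)) mem_vals.
  - by apply/setDP; rewrite (disjointFl (dis i iP)) mem_vals.
  move=> _ /(_ P3) H; apply: leq_trans (leq_trans H (separator_in_le _ _ _ _ _)).
  move: P3 t2; clear; move: #|P| t => p r p3 r2; nia.
have EP : #|P| = 2 by apply/eqP; rewrite eqn_leq P3.
have [j jP ji] := exists_other iP P2.
rewrite EP; apply: (@grid_cost P g i j) => //.
- apply/esym/eqP; rewrite eqEcard subUset !sub1set iP jP EP cards2.
  by rewrite eq_sym ji.
- by rewrite eq_sym.
- exact: dis.
- exact: dis.
Qed.

(** * The stronger separation bound for large sets *)

Lemma max_slice i Z : Z != set0 ->
  exists2 a, a \in vals i Z & #|Z| <= #|vals i Z| * #|slice Z i a|.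
Proof.
case/set0Pn=> z zZ; case: (@arg_maxnP _ (val z i) (mem (vals i Z)) (fun a => #|slice Z i a|)).
  exact: mem_vals.
move=> a aZ amax; exists a => //.
rewrite -[#|Z|]sum1_card (partition_big (fun f : V => val f i) (mem (vals i Z))) /=; last first.
  by move=> f; apply: mem_vals.
rewrite -sum_nat_const; apply: leq_sum => c cZ; rewrite sum1_card.
apply: leq_trans (amax c cZ); apply/subset_leq_card/subsetP=> f.
by rewrite !inE => /andP[-> ->].
Qed.

Lemma vals1_slice_cost (P : {set 'I_s}) g i Z B a : i \in P -> 2 < #|P| ->
  separated (cell P g) Z B -> vals i Z = [set a] -> a \notin vals i B ->
  2 * (#|P| * t) - 2 <= #|separator (cell P g) Z B|.
Proof.
move=> iP P3 /and3P[ZK BK _] Za aB.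
have Zai f : f \in Z -> val f i = a by move/(mem_vals i); rewrite Za => /set1P.
have /imsetP[z zZ az] : a \in vals i Z by rewrite Za set11.
apply: leq_trans (slice_cost sn iP Zai (pure_slice _ _ aB)).
rewrite az; apply: leq_trans (card_slice_ge sn iP P3 (subsetP ZK _ zZ)).
by move: P3 t2; clear; move: #|P| t => p r p3 r2; nia.
Qed.

(** The target is at most [2 * (#|P| * t) - 2], which three common slices already pay. With at most
    two, a largest slice of the contained set has a fair share of its vertices, and each pays for
    edges leaving it. If neither value set contains the other, a common slice plus a cross pair
    suffices, or two disjoint cross pairs, or a whole slice when one of the sets lies in a single
    slice. *)
Theorem cell_cost_large (P : {set 'I_s}) g Z B m : 2 < #|P| -> separated (cell P g) Z B ->
  Z != set0 -> B != set0 -> m <= #|Z| -> m <= #|B| -> m <= #|P| * t - 1 ->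
  #|P| * t - 1 + m <= #|separator (cell P g) Z B|.
Proof.
move=> P3 sep Z0 B0 mZ mB mP.
have /card_gt0P[i iP] : 0 < #|P| by apply: leq_trans P3.
have IHi g' Z' B' : separated (cell (P :\ i) g') Z' B' ->
    Z' != set0 -> B' != set0 -> #|P|.-1 * t <= #|separator (cell (P :\ i) g') Z' B'|.
  have -> : #|P|.-1 = #|P :\ i| by rewrite (cardsD1 i P) iP.
  exact: cell_cost.
have Mcost := mid_cost iP IHi sep (subxx _).
have Mle := leq_trans Mcost (separator_in_le _ _ _ _ _).
have [M3|M3] := ltnP 2 #|mids i Z B|.
  apply: leq_trans Mle.
  have : m <= #|P| * t - 1 by [].
  move: P3 t2 M3; clear; move: #|mids i Z B| #|P| t => x p r p3 r2 x3 mp.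
  apply: (@leq_trans (3 * (p.-1 * r))); last by rewrite leq_mul2r x3 orbT.
  by case: p p3 mp => // p p3 mp; rewrite /= in mp *; nia.
have side Z' B' : separated (cell P g) Z' B' -> B' != set0 -> m <= #|B'| ->
    #|mids i Z' B'| <= 2 -> vals i B' \subset vals i Z' ->
    #|P| * t - 1 + m <= #|separator (cell P g) Z' B'|.
  move=> sep' B0' mB' + sub; rewrite /mids (setIidPr sub) => M2.
  have [a aB Ba] := max_slice i B0'.
  apply: leq_trans (one_sided_cost iP IHi sep' sub aB).
  apply: side_arith2 => //; last exact: leq_trans mB' Ba.
    by rewrite M2 andbT; apply/card_gt0P; exists a.
  by apply: contraNT B0'; rewrite -eqn0Ngt => /eqP x0; rewrite -cards_eq0 -leqn0 -(muln0 #|vals i B'|) -x0.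
have [sub|nsub] := boolP (vals i B \subset vals i Z); first exact: side.
have [sub|nsub'] := boolP (vals i Z \subset vals i B).
  rewrite separator_sym; apply: side => //; first exact: separated_sym.
  by rewrite /mids setIC.
have [b bB bZ] := subsetPn nsub; have [a aZ aB] := subsetPn nsub'.
have aD : a \in vals i Z :\: vals i B by rewrite inE aZ aB.
have bD : b \in vals i B :\: vals i Z by rewrite inE bB bZ.
have [_ /(_ P3) Hc] := vals_cross_cost iP sep aD bD.
have [M0|M0] := posnP #|mids i Z B|; last first.
  apply: leq_trans (leq_trans (separator_in_add _ Z B i (disjoint_mids aD bD)) (separator_in_le _ _ _ _ _)).
  apply: leq_trans (leq_add Mcost Hc).
  have : m <= #|P| * t - 1 by [].
  move: P3 t2 M0; clear; move: #|mids i Z B| #|P| t => x p r p3 r2 x0 mp.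
  apply: (@leq_trans (p.-1 * r + (p + r - 2) * (p + r - 3))).
    by case: p p3 mp => [|[|[|p]]] // p3 mp; rewrite /= in mp *; case: r r2 mp => [|[|r]] // _; nia.
  by rewrite leq_add2r -{1}[p.-1 * r]mul1n leq_mul2r x0 orbT.
have dv : [disjoint vals i Z & vals i B].
  by rewrite -setI_eq0 -cards_eq0 -leqn0 -[_ :&: _]/(mids i Z B) M0.
have whole Z' B' c : separated (cell P g) Z' B' -> vals i Z' = [set c] -> c \notin vals i B' ->
    #|P| * t - 1 + m <= #|separator (cell P g) Z' B'|.
  move=> sep' Zc cB; apply: leq_trans (vals1_slice_cost iP P3 sep' Zc cB).
  by move: mP; clear; move: (#|P| * t) => x; lia.
have [Za|[a2 /setD1P[a2a a2Z]]] := set_0Vmem (vals i Z :\ a).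
  apply: (whole _ _ a) => //; apply/eqP; rewrite eqEsubset sub1set aZ andbT.
  by rewrite -setD_eq0 Za.
have [Bb|[b2 /setD1P[b2b b2B]]] := set_0Vmem (vals i B :\ b).
  rewrite separator_sym; apply: (whole _ _ b) => //; first exact: separated_sym.
  apply/eqP; rewrite eqEsubset sub1set bB andbT.
  by rewrite -setD_eq0 Bb.
have a2D : a2 \in vals i Z :\: vals i B by rewrite inE a2Z (disjointFr dv a2Z).
have b2D : b2 \in vals i B :\: vals i Z by rewrite inE b2B (disjointFl dv b2B).
have [_ /(_ P3) Hc2] := vals_cross_cost iP sep a2D b2D.
have dab : [disjoint [set a; b] & [set a2; b2]].
  have ne x y : x \in vals i Z -> y \in vals i B -> x != y.
    by move=> xZ yB; apply: contraTneq xZ => ->; rewrite (disjointFl dv yB).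
  rewrite disjoint_subset; apply/subsetP=> x; rewrite !inE => /orP[] /eqP->.
    by rewrite negb_or eq_sym a2a ne.
  by rewrite negb_or eq_sym ne //= eq_sym.
apply: leq_trans (leq_trans (separator_in_add _ Z B i dab) (separator_in_le _ _ _ _ _)).
apply: leq_trans (leq_add Hc Hc2).
have : m <= #|P| * t - 1 by [].
move: P3 t2; clear; move: #|P| t => p r p3 r2 mp.
by case: p p3 mp => [|[|[|p]]] // p3 mp; case: r r2 mp => [|[|r]] // _; nia.
Qed.
End Separation.

(** * Components after deleting few elements *)

Lemma double_count (T U : finType) (X : {set T}) (Y : {set U}) (R : T -> U -> bool) :
  \sum_(y in Y) #|[set x in X | R x y]| = \sum_(x in X) #|[set y in Y | R x y]|.
Proof.
have cardE (A : finType) (S : {set A}) (Q : pred A) :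
    #|[set z in S | Q z]| = \sum_(z in S) Q z.
  rewrite -sum1_card big_mkcond [RHS]big_mkcond; apply: eq_bigr => z _.
  by rewrite inE; case: (z \in S) => //=; case: (Q z).
under eq_bigr do rewrite cardE.
by rewrite exchange_big; apply: eq_bigr => x _; rewrite cardE.
Qed.

Lemma card_bigcup_le (T I : finType) (F : I -> {set T}) :
  #|\bigcup_j F j| <= \sum_j #|F j|.
Proof.
apply: (big_ind2 (fun (A : {set T}) m => #|A| <= m)) => // [|A x B y Ax By].
  by rewrite cards0.
exact: leq_trans (leq_card_setU _ _) (leq_add Ax By).
Qed.

(** If [c > m], a faulty vertex contributes [s] and a faulty edge [r.+1] to the right-hand side,
    with [v + e < s * r] in total; the heavier kind is the worst case, hence the split on
    [r.+1 <= s]. *)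
Lemma claw_arith m c f v e s r : 1 < r -> 2 < s -> v + e < s * r -> s * r <= m.+1 ->
  f <= m + v -> c * (s * r) <= s * f + (r - 1) * e + 2 * e -> c <= m.
Proof.
move=> r1 s2 ve mr fm Hc; rewrite leqNgt; apply/negP => mc.
have {Hc} : m.+1 * (s * r) <= s * (m + v) + r.+1 * e.
  apply: leq_trans (leq_trans (leq_mul mc (leqnn _)) Hc) _.
  by rewrite -addnA -mulnDl leq_add ?leq_mul //; lia.
have [rs|sr] := leqP r.+1 s => H.
  have : s * (m.+1 * r) <= s * (m + (v + e)).
    by rewrite mulnCA addnA mulnDr (leq_trans H) // leq_add2l leq_mul2r rs orbT.
  rewrite leq_pmul2l; last by lia.
  have : m.+1 * 2 <= m.+1 * r by rewrite leq_mul2l r1 orbT.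
  lia.
have {}H : m.+1 * (s * r) <= s * m + r.+1 * (v + e).
  by rewrite (leq_trans H) // !mulnDr addnA leq_add2r leq_add2l leq_mul2r (ltnW sr) orbT.
move: ve mr H; set q := s * r; have -> : m.+1 * q = m * s * r + q by rewrite mulSn addnC mulnA.
case: r r1 @q sr => // r r1 q sr ve mr; rewrite mulnS.
have Hq : r.+2 * (v + e) <= r.+2 * q.-1 by rewrite leq_mul2l /=; lia.
have Hm : q.-1 * (s * r) <= m * (s * r) by rewrite leq_mul2r; apply/orP; right; lia.
have Hr : q.-1 * r.+2 <= q.-1 * (s * r).+1 by rewrite leq_mul2l; apply/orP; right; nia.
rewrite -mulnA => H; have q0 : 0 < q by lia.
rewrite [X in _ <= X]mulnC in Hr *.
nia.
Qed.

Lemma arr_vertex_inhabited n s : s <= n -> arr_vertex n s.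
Proof.
move=> sn; exists [ffun i : 'I_s => widen_ord sn i].
by apply/injectiveP=> i j; rewrite !ffunE => /(congr1 val) /= /val_inj.
Qed.

Section Faults.
Variables n s : nat.
Hypotheses (s2n : s.+1 < n) (s3 : 2 < s).
Notation V := (arr_vertex n s).
Notation t := (n - s).
Let sn : s < n := ltnW s2n.
Let t2 : 1 < t. Proof. by rewrite ltn_subRL addn1. Qed.

Lemma cell_setT (g : V) : cell setT g = setT.
Proof. by apply/setP=> f; rewrite in_setT; apply/cellP => j; rewrite inE. Qed.

(** The constants fit [few_barrier]: [m + fv] deleted and [3 * m + 2] remaining vertices, with
    [m <= s * t - 2] and [fv <= s * t - 1], add up to at most [5 * (s * t) - 7]. *)
Lemma card_arr_vertex_ge (g : V) : 5 * (s * t) <= #|{: V}| + 7.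
Proof.
have i0 : 'I_s := Ordinal (leq_trans (isT : 0 < 3) s3).
have iT : i0 \in [set: 'I_s] by rewrite in_setT.
have P3 : 2 < #|[set: 'I_s]| by rewrite cardsT card_ord.
have Hs a : (s + t - 1) * (s + t - 2) <= #|slice [set: V] i0 a|.
  have mK : set_value g i0 a \in cell setT g by rewrite cell_setT in_setT.
  by have := card_slice_ge sn iT P3 mK; rewrite cell_setT set_value_at cardsT card_ord.
have : n * ((s + t - 1) * (s + t - 2)) <= #|{: V}|.
  rewrite -[#|{: V}|]sum1_card (partition_big (fun f : V => val f i0) predT) //=.
  rewrite -[n in n * _](card_ord n) -sum_nat_const; apply: leq_sum => a _.
  rewrite sum1_card; apply: leq_trans (Hs a) _; apply/subset_leq_card/subsetP=> f.
  by rewrite !inE.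
move: t2 s3 (subnKC (ltnW sn)); clear; move: #|_| t => x r r2 s3 <-.
rewrite [s + (r)]addnC; nia.
Qed.

(** [X] is meant as the [fv] faulty vertices together with a barrier of [m] vertices, and [FE] as
    the faulty edges. *)
Variables (X : {set V}) (FE : {set {set V}}) (m fv : nat).
Variables (L : finType) (lab : V -> L).
Hypotheses (Xle : #|X| <= m + fv) (few : fv + #|FE| < s * t).
Hypothesis lab_edge : forall u v, u \notin X -> v \notin X -> arr_adj u v ->
  [set u; v] \notin FE -> lab u = lab v.

Let cross_FE u v : u \notin X -> v \notin X -> arr_adj u v -> lab u != lab v ->
  [set u; v] \in FE.
Proof. by move=> uX vX uv; apply: contraNT => /(lab_edge uX vX uv) ->. Qed.

Definition class (Y : {set L}) := [set u : V | (u \notin X) && (lab u \in Y)].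

Lemma class_cost (Y : {set L}) : #|separator setT (class Y) (class (~: Y))| <= #|X| + #|FE|.
Proof.
pose D := [set p : V * V | [&& p.1 \in class Y, p.2 \in class (~: Y) & arr_adj p.1 p.2]].
have sub : separator setT (class Y) (class (~: Y)) \subset (fun x => (x, x)) @: X :|: D.
  apply/subsetP=> -[u v]; rewrite inE /= => /orP[|H]; last by rewrite in_setU [X in _ || X]inE H orbT.
  case/andP=> /eqP<- H; rewrite in_setU imset_f //; move: H.
  by rewrite !inE; case: (u \in X) => //=; case: (lab u \in Y).
apply: leq_trans (subset_leq_card sub) _; apply: leq_trans (leq_card_setU _ _) _.
apply: leq_add; first exact: leq_imset_card.
have DP p : p \in D -> [/\ p.1 \notin X, lab p.1 \in Y, p.2 \notin X, lab p.2 \notin Y & arr_adj p.1 p.2].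
  by rewrite !inE => /and3P[/andP[-> ->] /andP[-> ->] ->].
rewrite -(@card_in_imset _ _ (fun p => [set p.1; p.2])).
  apply/subset_leq_card/subsetP=> e /imsetP[p /DP[p1X p1Y p2X p2Y adj] ->].
  by apply: cross_FE => //; apply: contraNneq p2Y => <-.
move=> p q /DP[p1X p1Y p2X p2Y adj] /DP[_ q1Y _ q2Y _].
case/(set2_eq (adj_neq adj)) => -[E1 E2].
  by rewrite [p]surjective_pairing E1 E2 -surjective_pairing.
by rewrite E1 (negPf q2Y) in p1Y.
Qed.

(** Two sides of at least [m.+1] vertices would cost [s * t - 1 + m.+1], one more than the
    [m + s * t - 1] deletions available. *)
Lemma class_small (Y : {set L}) : m.+1 < s * t ->
  (#|class Y| <= m) || (#|class (~: Y)| <= m).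
Proof.
move=> ms; apply: contraT; rewrite negb_or -!ltnNge => /andP[Zm Bm].
have Z0 : class Y != set0 by rewrite -card_gt0; apply: leq_trans Zm.
have B0 : class (~: Y) != set0 by rewrite -card_gt0; apply: leq_trans Bm.
have /set0Pn[g _] := Z0.
have sep : separated (cell setT g) (class Y) (class (~: Y)).
  rewrite cell_setT /separated !subsetT disjoint_subset /=; apply/subsetP=> u.
  by rewrite !inE => /andP[_ ->]; rewrite andbF.
have P3 : 2 < #|[set: 'I_s]| by rewrite cardsT card_ord.
have := @cell_cost_large _ _ s2n setT g _ _ m.+1 P3 sep Z0 B0 Zm Bm.
rewrite cell_setT cardsT card_ord => /(_ _)/leq_trans/(_ (class_cost Y)).
move: ms Xle few; clear; move: #|X| #|FE| (s * t) => x y r; lia.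
Qed.

Let labels := lab @: ~: X.

(** A largest union of classes with at most [m] vertices exceeds [m] as soon as one more label [y]
    is added, so what lies beyond has at most [m] vertices as well. Of at least [3 * m + 2] vertices
    the class of [y] therefore has [m + 2] or more; its complement is then small and carries at most
    [m] further labels. *)
Lemma few_barrier : m.+1 < s * t ->
  #|labels| <= m.+1 /\ exists u v, [/\ u \notin X, v \notin X, u != v & lab u = lab v].
Proof.
move=> ms.
have classU (Y Y' : {set L}) : class (Y :|: Y') = class Y :|: class Y'.
  by apply/setP=> u; rewrite !inE andb_orr.
have class_compl (Y : {set L}) : #|class Y| + #|class (~: Y)| = #|~: X|.
  rewrite -(cardsID (class Y) (~: X)); congr (_ + _); apply: eq_card => u.
    by rewrite !inE; case: (u \in X).
  by rewrite !inE; case: (u \in X); rewrite ?andbF ?andbT.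
have class0 : #|class set0| <= m.
  by rewrite (_ : class set0 = set0) ?cards0 //; apply/setP=> u; rewrite !inE andbF.
case: (@arg_maxnP _ (set0 : {set L}) (fun Y => #|class Y| <= m) (fun Y => #|class Y|) class0).
move=> Y Ym Ymax.
have cW : 3 * m + 2 <= #|~: X|.
  have := card_arr_vertex_ge (arr_vertex_inhabited (ltnW sn)); rewrite -(cardsC X).
  move: ms Xle few; clear; move: #|X| #|~: X| #|FE| (s * t) => x w e r; lia.
have [u uX uY] : exists2 u, u \notin X & lab u \notin Y.
  have : 0 < #|class (~: Y)| by move: (class_compl Y) cW Ym; clear; lia.
  by case/card_gt0P=> u; rewrite !inE => /andP[uX uY]; exists u.
pose y := lab u.
have yY : #|class (y |: Y)| = #|class [set y]| + #|class Y|.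
  rewrite classU -cardsUI (_ : _ :&: _ = set0) ?cards0 ?addn0 //.
  apply/setP=> v; rewrite !inE; apply/negbTE/negP => /andP[/andP[_ /eqP vy] /andP[_ vY]].
  by rewrite -(vy : lab v = lab u) vY in uY.
have y0 : 0 < #|class [set y]| by apply/card_gt0P; exists u; rewrite !inE uX eqxx.
have big : m < #|class (y |: Y)|.
  rewrite ltnNge; apply/negP => /Ymax; rewrite yY; move: y0; clear; lia.
have {big} small : #|class (~: (y |: Y))| <= m.
  by have := class_small (y |: Y) ms; rewrite leqNgt big.
have ybig : m.+2 <= #|class [set y]|.
  move: (class_compl (y |: Y)) yY small Ym cW; clear; lia.
have rest : #|class (~: [set y])| <= m.
  have := class_small [set y] ms; rewrite leqNgt ltnW //.
split.
  have sub : labels \subset y |: lab @: class (~: [set y]).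
    apply/subsetP=> x /imsetP[v vX ->]; rewrite in_setU1.
    have [//|vy] := eqVneq (lab v) y; apply/orP; right; apply: imset_f.
    by rewrite !inE vy andbT; rewrite inE in vX.
  apply: leq_trans (subset_leq_card sub) _; rewrite cardsU1.
  apply: (leq_add (leq_b1 _)); apply: leq_trans rest; exact: leq_imset_card.
have : 0 < #|class [set y] :\ u|.
  have uy : u \in class [set y] by rewrite !inE uX eqxx.
  have := cardsD1 u (class [set y]); rewrite uy; move: ybig; clear.
  by move: #|class [set y]| #|_ :\ _| => a b; lia.
case/card_gt0P=> v; rewrite !inE => /and3P[vu vX /eqP vy]; exists u, v.
by split=> //; rewrite eq_sym.
Qed.

(* Each position contributes to a vertex x one clique, which meets at most one
   class unless it contains faulty edges. *)
Definition ray j (x : V) := [set u : V | adj_at j x u].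

(** Fix [u] in the clique and one representative of every other label it meets: each edge from [u]
    to a representative joins different labels, hence is faulty, and these edges are distinct. *)
Lemma ray_labels j (x : V) :
  #|lab @: (ray j x :\: X)| <= 1 + #|[set e in FE | (e \in arr_E n s) && (e \subset ray j x)]|.
Proof.
have [->|[u uR]] := set_0Vmem (ray j x :\: X); first by rewrite imset0 cards0.
rewrite (cardsD1 (lab u)); apply: leq_add; first exact: leq_b1.
pose rep y := odflt u [pick v in ray j x :\: X | lab v == y].
have repP y : y \in lab @: (ray j x :\: X) -> rep y \in ray j x :\: X /\ lab (rep y) = y.
  case/imsetP=> v vR ->; rewrite /rep; case: pickP => [w /andP[wR /eqP]//|/(_ v)].
  by rewrite vR eqxx.
rewrite -(@card_in_imset _ _ (fun y => [set u; rep y])).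
  apply/subset_leq_card/subsetP=> e /imsetP[y /setD1P[yu /repP[rR ry]] ->].
  have [+ rX] := setDP rR; rewrite inE => xr.
  have [+ uX] := setDP uR; rewrite inE => xu.
  have ur : u != rep y by apply: contraNneq yu => ->; rewrite ry.
  have adj : arr_adj u (rep y).
    apply/arr_adjP; exists j; move/adj_atP: (xr) => [_ xrj]; move/adj_atP: (xu) => [_ xuj].
    have off i : i != j -> val u i = val (rep y) i by move=> ij; rewrite -xuj ?xrj.
    apply/adj_atP; split=> //; apply: contraNneq ur => E; apply/eqP/eq_arr => i.
    by have [->|/off] := eqVneq i j.
  have urE : [set u; rep y] \in arr_E n s.
    by rewrite inE; apply/existsP; exists u; apply/existsP; exists (rep y); rewrite eqxx.
  rewrite inE urE cross_FE ?ry //=; last by rewrite eq_sym.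
  by rewrite subUset !sub1set !inE xu xr.
move=> y y' /setD1P[yu /repP[_ ry]] /setD1P[yu' /repP[_ ry']].
have ur : u != rep y by apply: contraNneq yu => ->; rewrite ry.
by case/(set2_eq ur) => -[_ E2]; [rewrite -ry E2 | rewrite E2 eqxx in ur].
Qed.

(** An edge determines its direction and its clique of [t.+1] vertices; [x] must be one of the
    [t - 1] vertices of the clique that are not ends of the edge. *)
Lemma card_rays (e : {set V}) : e \in arr_E n s ->
  \sum_j #|[set x in X | e \subset ray j x]| <= t - 1.
Proof.
rewrite inE => /existsP[u /existsP[v /andP[/eqP-> /arr_adjP[j0 /adj_atP[uv0 uv]]]]].
have sub2 j x : [set u; v] \subset ray j x -> adj_at j x u /\ adj_at j x v.
  by rewrite subUset !sub1set !inE => /andP.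
rewrite (bigD1 j0) //= big1 ?addn0 => [|j jj0].
  have inj : {in [set x in X | [set u; v] \subset ray j0 x] &,
      injective (fun x : V => val x j0)}.
    move=> x x' /setIdP[_ /sub2[/adj_atP[_ xu] _]] /setIdP[_ /sub2[/adj_atP[_ xu'] _]] E.
    apply: eq_arr => j; have [->//|jj0] := eqVneq j j0.
    by rewrite xu ?xu'.
  rewrite -(card_in_imset inj).
  have vj : val v j0 \notin image_of u.
    apply/imsetP => -[j _ E]; have [jj0|jj0] := eqVneq j j0.
      by rewrite E jj0 eqxx in uv0.
    by rewrite uv // in E; rewrite (arrI E) eqxx in jj0.
  apply: (@leq_trans #|~: (val v j0 |: image_of u)|).
    apply/subset_leq_card/subsetP=> c /imsetP[x /setIdP[_ /sub2[/adj_atP[xu0 xu] /adj_atP[xv0 _]]] ->].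
    rewrite in_setC in_setU1 negb_or xv0 /=; apply/imsetP => -[j _ E].
    have [jj0|jj0] := eqVneq j j0; first by rewrite E jj0 eqxx in xu0.
    by rewrite -xu // in E; rewrite (arrI E) eqxx in jj0.
  by rewrite cardsCs setCK cardsU1 vj card_image_of card_ord subnDA subn1 -subn1 subnAC.
apply/eqP; rewrite cards_eq0; apply/eqP/setP=> x; rewrite in_set0; apply/negbTE/negP.
case/setIdP=> _ /sub2[/adj_atP[_ xu] /adj_atP[_ xv]].
by rewrite -xu 1?eq_sym // -xv 1?eq_sym // eqxx in uv0.
Qed.

Definition labels_at x := lab @: [set u | (u \notin X) && arr_adj x u].

Lemma sum_labels_at :
  \sum_(x in X) #|labels_at x| <= s * #|X| + (t - 1) * #|FE|.
Proof.
pose F j x := #|[set e in FE :&: arr_E n s | e \subset ray j x]|.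
have Hx x : #|labels_at x| <= s + \sum_j F j x.
  have sub : labels_at x \subset \bigcup_j lab @: (ray j x :\: X).
    apply/subsetP=> y /imsetP[u]; rewrite inE => /andP[uX /arr_adjP[j xu]] ->.
    by apply/bigcupP; exists j => //; apply: imset_f; rewrite !inE uX.
  apply: leq_trans (subset_leq_card sub) _; apply: leq_trans (card_bigcup_le _) _.
  rewrite -[s in s + _](card_ord s) -[#|_|]sum1_card -big_split /=.
  apply: leq_sum => j _; apply: leq_trans (ray_labels j x) _.
  rewrite leq_add2l; apply/subset_leq_card/subsetP=> e.
  by case/setIdP=> eF /andP[eE er]; apply/setIdP; split=> //; apply/setIP.
apply: (@leq_trans (\sum_(x in X) (s + \sum_j F j x))).
  by apply: leq_sum => x _; apply: Hx.
rewrite big_split /= sum_nat_const mulnC leq_add2l.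
rewrite exchange_big /=.
under eq_bigr do rewrite -double_count.
rewrite exchange_big /=.
apply: (@leq_trans (\sum_(e in FE :&: arr_E n s) (t - 1))).
  by apply: leq_sum => e /setIP[_ eE]; apply: card_rays.
by rewrite sum_nat_const mulnC leq_mul2l subset_leq_card ?orbT // subsetIl.
Qed.

Let cross := [set p : V * V | [&& p.1 \notin X, p.2 \notin X, lab p.1 != lab p.2 & arr_adj p.1 p.2]].

Lemma card_cross : #|cross| <= 2 * #|FE|.
Proof.
rewrite -sum1_card (partition_big (fun p => [set p.1; p.2]) (mem FE)) /=; last first.
  by move=> p; rewrite inE => /and4P[p1 p2 pl pa]; apply: cross_FE.
rewrite mulnC -sum_nat_const; apply: leq_sum => e eF; rewrite sum1_card.
case: (pickP [pred p in cross | [set p.1; p.2] == e]) => [p /= /andP[pc /eqP pe]|E].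
  apply: (@leq_trans #|[set p; (p.2, p.1)]|); last by rewrite cards2; case: eqP.
  apply/subset_leq_card/subsetP=> q; rewrite inE => /andP[qc /eqP qe].
  have : q.1 != q.2 by move: qc; rewrite inE => /and4P[_ _ _ /adj_neq].
  move/set2_eq => /(_ p.1 p.2); rewrite qe pe => /(_ erefl).
  by case=> -[E1 E2]; rewrite [q]surjective_pairing E1 E2 !inE -?surjective_pairing eqxx ?orbT.
by rewrite (eq_card0 E).
Qed.

Lemma many_barrier : s * t <= m.+1 -> #|labels| <= m.
Proof.
move=> ms; have d0 : 1 < s * t by move: s3 t2; clear; move: t => r; nia.
(* Two labels are needed below, so that the rest of the graph is nonempty when one class is cut
   off. *)
have [c1|c2] := leqP #|labels| 1; first by apply: leq_trans c1 _; rewrite -ltnS (leq_trans d0).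
apply: (@claw_arith m _ #|X| fv #|FE| s t) => //.
pose NX y := [set x in X | y \in labels_at x].
pose D y := [set p in cross | lab p.1 == y].
have Hy y : y \in labels -> s * t <= #|NX y| + #|D y|.
  case/imsetP=> g gX Ey.
  have gX' : g \notin X by rewrite inE in gX.
  (* [B] keeps the deleted vertices with no neighbour in the class, so that the label pays only for
     those adjacent to it. *)
  pose Z := class [set y]; pose B := ~: (Z :|: NX y).
  have gZ : g \in Z by rewrite !inE gX' Ey eqxx.
  have [b bB] : exists b, b \in B.
    have : 0 < #|labels :\ y|.
      by have := cardsD1 y labels; move: c2; clear; case: (y \in labels) => /=; lia.
    case/card_gt0P=> y' /setD1P[y'y /imsetP[b bX E]]; exists b; rewrite inE in bX.
    by rewrite !inE (negPf bX) /= -E (negPf y'y).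
  have sep : separated (cell setT g) Z B.
    rewrite cell_setT /separated !subsetT disjoint_subset /=; apply/subsetP=> u uZ.
    by rewrite inE /= in_setC in_setU uZ.
  have := cell_cost s2n sep; rewrite cardsT card_ord => /(_ _ _)/leq_trans; apply.
  - by apply/set0Pn; exists g.
  - by apply/set0Pn; exists b.
  have sub : separator (cell setT g) Z B \subset (fun x => (x, x)) @: NX y :|: D y.
    apply/subsetP=> -[u v]; rewrite inE /= => /orP[/andP[/eqP<-]|/and3P[uZ vB uv]].
      case/setDP=> _; rewrite in_setU negb_or => /andP[/negPf uZ].
      by rewrite /B in_setC negbK in_setU uZ => uN; rewrite in_setU imset_f.
    have /setIdP[uX /set1P uy] := uZ.
    move: vB; rewrite /B in_setC in_setU negb_or => /andP[vZ vN].
    have vX : v \notin X.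
      apply: contra vN => vX; rewrite inE vX; apply/imsetP; exists u => //.
      by rewrite inE uX adj_sym.
    apply/setUP; right; rewrite inE /= uy eqxx andbT inE /= uX vX uv uy andbT.
    by move: vZ; rewrite !inE vX /= eq_sym.
  apply: leq_trans (subset_leq_card sub) _; apply: leq_trans (leq_card_setU _ _) _.
  by rewrite leq_add2r leq_imset_card.
rewrite -sum_nat_const; apply: (@leq_trans (\sum_(y in labels) (#|NX y| + #|D y|))).
  by apply: leq_sum => y; apply: Hy.
rewrite big_split /=.
apply: leq_add.
  rewrite double_count; apply: leq_trans sum_labels_at; apply: leq_sum => x _.
  by apply/subset_leq_card/subsetP=> y; rewrite inE => /andP[].
apply: leq_trans card_cross; rewrite -[#|cross|]sum1_card.
rewrite (partition_big (fun p => lab p.1) (mem labels)) /=; last first.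
  by move=> p; rewrite inE => /and4P[p1 _ _ _]; apply: imset_f; rewrite inE.
apply: leq_sum => y _; rewrite sum1_card; apply/subset_leq_card/subsetP=> p.
by case/setIdP=> pc pl; apply/andP.
Qed.

Lemma barrier_bound : #|labels| <= m \/
  #|labels| <= m.+1 /\ exists u v, [/\ u \notin X, v \notin X, u != v & lab u = lab v].
Proof.
by have [ms|ms] := ltnP m.+1 (s * t); [right; apply: few_barrier|left; apply: many_barrier].
Qed.
End Faults.

(** * Matching preclusion *)

Lemma bigmin_eq (T : finType) (P : pred T) (F : T -> nat) x0 d j :
  (forall i, P i -> d <= F i) -> d <= x0 -> P j -> F j <= d ->
  \big[minn/x0]_(i | P i) F i = d.
Proof.
move=> dF dx Pj Fj; apply/eqP; rewrite eqn_leq; apply/andP; split; last first.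
  by apply: (big_ind (fun x => d <= x)) => // x y dx' dy; rewrite leq_min dx'.
apply: leq_trans Fj; have : j \in index_enum T by rewrite mem_index_enum.
elim: (index_enum T) => // i r IH; rewrite inE big_cons => /orP[/eqP<-|/IH H].
  by rewrite Pj geq_minl.
by case: ifP => // _; apply: leq_trans (geq_minr _ _) H.
Qed.

Section Preclusion.
Variables n s k : nat.
Hypotheses (s2n : s.+1 < n) (s3 : 2 < s) (k0 : 0 < k).
Notation V := (arr_vertex n s).
Notation t := (n - s).

Lemma arr_E_adj (u v : V) : arr_adj u v -> [set u; v] \in arr_E n s.
Proof. by move=> uv; rewrite inE; apply/existsP; exists u; apply/existsP; exists v; rewrite eqxx. Qed.

Lemma few_faults (FV : {set V}) (FE : {set {set V}}) : #|FV| + #|FE| < s * t ->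
  has_perfect_or_almost_perfect k (del_vertices (arr_V n s) FV) (del_edges (arr_E n s) FV FE).
Proof.
move=> few; have [//|[S [I [L [lab [SV IV Iiso Hlab]]]]]] :=
  kmatching_or_barrier (del_vertices (arr_V n s) FV) (del_edges (arr_E n s) FV FE) k0.
set W := _ :\: S in IV Iiso Hlab *; move=> bar; exfalso.
pose X := FV :|: S.
have XW u : (u \notin X) = (u \in W) by rewrite !inE negb_or andbT andbC.
(* Isolated vertices get private labels, so the number of labels is at least the number of isolated
   vertices plus the number of labels of the others. *)
pose lab' u : V + L := if u \in I then inl u else inr (lab u).
have Xle : #|X| <= #|S| + #|FV| by rewrite addnC leq_card_setU.
have compat u v : u \notin X -> v \notin X -> arr_adj u v -> [set u; v] \notin FE ->
    lab' u = lab' v.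
  move=> uX vX uv uvF; have uv' := adj_neq uv.
  have uvE : [set u; v] \in del_edges (arr_E n s) FV FE.
    rewrite inE in_setD uvF arr_E_adj //= disjoints_subset subUset !sub1set !inE.
    by move: uX vX; rewrite !inE !negb_or => /andP[-> _] /andP[-> _].
  rewrite /lab'; rewrite !XW in uX vX.
  case: ifPn => [uI|uI]; first by have := Iiso u v uI vX uv'; rewrite uvE.
  case: ifPn => [vI|vI].
    by have := Iiso v u vI uX; rewrite eq_sym uv' setUC uvE => /(_ isT).
  by rewrite (Hlab u v) // inE ?uI ?vI.
have cardl : #|I| + #|lab @: (W :\: I)| <= #|lab' @: ~: X|.
  have inlI : injective (@inl V L) by move=> x y [].
  have inrI : injective (@inr V L) by move=> x y [].
  rewrite -(card_imset I inlI) -(card_imset (lab @: _) inrI) -cardsUI.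
  rewrite (_ : _ :&: _ = set0) ?cards0 ?addn0; last first.
    by apply/setP=> x; rewrite in_set0; apply/negP => /setIP[/imsetP[u _ ->] /imsetP[]].
  apply/subset_leq_card/subsetP=> x /setUP[/imsetP[u uI ->]|/imsetP[y /imsetP[u uW ->] ->]].
    apply/imsetP; exists u; last by rewrite /lab' uI.
    by rewrite in_setC XW (subsetP IV).
  have /setDP[uW' uI] := uW.
  by apply/imsetP; exists u; rewrite ?in_setC ?XW // /lab' (negPf uI).
case: (barrier_bound s2n s3 Xle few compat) => [H|[H [u [v [uX vX uv luv]]]]].
  move: bar (leq_trans cardl H) k0; clear.
  move: #|I| #|lab @: (W :\: I)| #|S| => i c m; nia.
(* A label shared by two vertices is not private, so some vertex is not isolated. *)
have c0 : 0 < #|lab @: (W :\: I)|.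
  apply/card_gt0P; exists (lab u); apply: imset_f; rewrite in_setD -XW uX andbT.
  apply/negP => uI; move: luv; rewrite /lab' uI; case: ifP => // _ [E].
  by rewrite E eqxx in uv.
move: bar (leq_trans cardl H) k0 c0; clear.
move: #|I| #|lab @: (W :\: I)| #|S| => i c m; nia.
Qed.

(** * The upper bound: isolating one vertex *)

Definition star (v : V) : {set {set V}} := [set e in arr_E n s | v \in e].

Lemma card_star v : #|star v| <= s * t.
Proof.
have -> : s * t = #|setX [set: 'I_s] (~: image_of v)|.
  by rewrite cardsX cardsT card_ord cardsCs setCK card_image_of card_ord.
apply: leq_trans (leq_imset_card (fun p => [set v; set_value v p.1 p.2]) _).
apply/subset_leq_card/subsetP=> e; rewrite inE => /andP[eE ve].
have [u vu Ee] : exists2 u, arr_adj v u & e = [set v; u].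
  move: eE ve; rewrite inE => /existsP[a /existsP[b /andP[/eqP-> ab]]] /set2P[->|->].
    by exists b.
  by exists a; rewrite 1?adj_sym // setUC.
have /arr_adjP[i /adj_atP[ui uj]] := vu.
have uN j : val v j != val u i.
  have [->//|ji] := eqVneq j i; rewrite uj //.
  by apply: contraNneq ji => /arrI->.
apply/imsetP; exists (i, val u i).
  by rewrite in_setX in_setT in_setC; apply/imsetP => -[j _ /eqP]; rewrite eq_sym (negPf (uN j)).
rewrite Ee; congr [set _; _]; apply: eq_arr => j /=.
by have [->|ji] := eqVneq j i; rewrite ?set_value_at // set_value_other // uj.
Qed.

(** The isolated vertex has sum 0, which for [k > 1] is neither [k] nor [k - 1]. *)
Lemma star_destroys v : 1 < k -> smp_destroys k (arr_V n s) (arr_E n s) (set0, star v).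
Proof.
move=> k1; apply/and3P; split; first exact: sub0set.
  by apply/subsetP=> e; rewrite inE => /andP[].
apply/existsP => -[h]; set Es := del_edges _ _ _.
have deg0 : hdeg Es h v = 0.
  rewrite /hdeg big1 // => e /andP[/setIdP[/setDP[eE eN] _] ve].
  by move: eN; rewrite inE eE ve.
have vV : v \in del_vertices (arr_V n s) set0 by rewrite !inE.
by case/orP=> [/forall_inP/(_ v vV)|/and3P[_ _ /forall_inP/(_ v vV)]];
   rewrite deg0; move: k1; clear; case: k => [|[]].
Qed.
End Preclusion.

Theorem theorem3p14 (k n s : nat) :
  odd k -> 3 <= k -> 3 <= s -> s <= n - 2 ->
  smp k (arr_V n s) (arr_E n s) = s * (n - s).
Proof.
move=> _ k3 s3 sn2; have s2n : s.+1 < n by lia.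
have v := arr_vertex_inhabited (ltnW (ltnW s2n)).
have D := @star_destroys n s k v (ltnW k3).
have lower F : smp_destroys k (arr_V n s) (arr_E n s) F -> s * (n - s) <= #|F.1| + #|F.2|.
  case/and3P=> _ _; apply: contraR; rewrite -ltnNge.
  by apply: few_faults => //; apply: leq_trans k3.
apply: (bigmin_eq lower _ D); last by rewrite cards0 card_star.
(* The default value of the minimum is no smaller than the bound, because the star is itself a pair
   of subsets of the vertices and of the edges. *)
have /and3P[sV sE _] := D; apply: leq_trans (lower _ D) _.
by apply: leq_add; apply: subset_leq_card.
Qed.
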